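(* Let $(\mathcal V,m,b)$ be a weighted graph over $\mathcal G_d=(\mathcal V,\mathcal E)$ with associated Laplacian $\mathbf h$ in $\ell^2(\mathcal V;m)$, and let $d:\mathcal E\to\mathbb R_{>0}$. If $d$ is an intrinsic weight, i.e. $\sum_{e\in\mathcal E_v}d(e)^2b(e)\le m(v)$ for all $v\in\mathcal V$, then $$\lambda_0(\mathbf h)\ge\tfrac12\,\alpha^2,\qquad \lambda_0^{\mathrm{ess}}(\mathbf h)\ge\tfrac12\,\alpha_{\mathrm{ess}}^2 ,$$ where $\alpha$ and $\alpha_{\mathrm{ess}}$ are the isoperimetric constant and the isoperimetric constant at infinity with respect to $d$.
   Context: $\mathcal G_d=(\mathcal V,\mathcal E)$ is an unoriented, connected, locally finite, simple graph with countably infinite $\mathcal V$ and $\mathcal E$; $\mathcal E_v$ is the set of edges incident to $v$. $m:\mathcal V\to\mathbb R_{>0}$ and $b:\mathcal V\times\mathcal V\to\mathbb R_{\ge0}$ are weights with $b(u,v)=b(v,u)$ and $b(u,v)\neq0$ only if $u\sim v$; for an edge $e$ joining $u$ and $v$ write $b(e)=b(u,v)$. Operator. $(\tau f)(v)=\frac1{m(v)}\sum_{u\sim v}b(u,v)(f(v)-f(u))$ on finitely supported functions defines a nonnegative symmetric operator in $\ell^2(\mathcal V;m)$ (norm $\|f\|^2=\sum_v|f(v)|^2m(v)$); $\mathbf h$ is its Friedrichs extension. $\lambda_0(\mathbf h)=\inf\sigma(\mathbf h)$, $\lambda_0^{\mathrm{ess}}(\mathbf h)=\inf\sigma_{\mathrm{ess}}(\mathbf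 h)$ ($=+\infty$ if $\sigma_{\mathrm{ess}}(\mathbf h)=\varnothing$). Isoperimetric constants. For $X\subseteq\mathcal V$, $\mathcal E_b(X)$ is the set of edges connecting $X$ and $\mathcal V\setminus X$, $m(X)=\sum_{v\in X}m(v)$, $(d\cdot b)(\mathcal E_b(X))=\sum_{e\in\mathcal E_b(X)}d(e)b(e)$. For $U\subseteq\mathcal V$, $$\alpha_d(U)=\inf_{X\subseteq U,\ X\text{ finite, nonempty}}\frac{(d\cdot b)(\mathcal E_b(X))}{m(X)},$$ $\alpha=\alpha_d(\mathcal V)$ and $\alpha_{\mathrm{ess}}=\sup_{X\subseteq\mathcal V\text{ finite}}\alpha_d(\mathcal V\setminus X)$. *)

(* Defs.v *)
From HB Require Import structures.
From mathcomp Require Import all_boot all_order all_algebra finmap complex.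
From mathcomp Require Import all_classical all_reals all_analysis.

Set Implicit Arguments.
Unset Strict Implicit.
Unset Printing Implicit Defensive.

Import Order.TTheory GRing.Theory Num.Theory numFieldNormedType.Exports.

Local Open Scope classical_set_scope.
Local Open Scope ring_scope.
Local Open Scope complex_scope.

Section Graph.
Variable V : choiceType.
Implicit Types (adj : rel V) (v : V) (X : set V).

Definition edges adj : set {fset V} :=
  [set e | exists u v, adj u v /\ e = [fset u; v]%fset].

Definition edges_at adj v : set {fset V} :=
  [set e | edges adj e /\ v \in e].

Definition edge_boundary adj X : set {fset V} :=
  [set e | exists u v, [/\ X u, ~ X v, adj u v & e = [fset u; v]%fset]].

Record is_graph adj : Prop := IsGraph {
  graph_sym : forall u v, adj u v = adj v u;
  graph_irr : forall v, ~~ adj v v;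
  graph_connected : forall u v, exists p : seq V, path adj u p /\ last u p = v;
  graph_locally_finite : forall v, finite_set (edges_at adj v);
  graph_vertices : ([set: V] #= [set: nat])%card;
  graph_edges : (edges adj #= [set: nat])%card }.

End Graph.

Section WeightedGraph.
Variables (R : realType) (V : choiceType).
Implicit Types (adj : rel V) (m : V -> R) (b : V -> V -> R) (d : {fset V} -> R).

Record is_weight adj m b : Prop := IsWeight {
  weight_vertex_gt0 : forall v, 0 < m v;
  weight_ge0 : forall u v, 0 <= b u v;
  weight_sym : forall u v, b u v = b v u;
  weight_support : forall u v, b u v != 0 -> adj u v }.

(* b e = b u v when e = {u, v}; unambiguous because b is symmetric. *)
Definition edge_weight b (e : {fset V}) : R :=
  xget 0 [set r | exists u v, e = [fset u; v]%fset /\ r = b u v].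

Definition intrinsic adj m b d : Prop :=
  forall v, \sum_(e \in edges_at adj v) (d e ^+ 2 * edge_weight b e) <= m v.

Definition isoperimetric adj m b d (U : set V) : \bar R :=
  ereal_inf [set ((\sum_(e \in edge_boundary adj X) (d e * edge_weight b e))
                  / \sum_(v \in X) m v)%:E
            | X in [set X | [/\ X `<=` U, finite_set X & X !=set0]]].

Definition isoperimetric_ess adj m b d : \bar R :=
  ereal_sup [set isoperimetric adj m b d (~` X) | X in [set X | finite_set X]].

End WeightedGraph.

(* The complex Hilbert space ell^2(V; m).  Since m > 0, its elements are honest
   functions and no quotient is needed. *)
Section L2.
Variables (R : realType) (V : choiceType) (m : V -> R).
Implicit Types (f g w : V -> R[i]) (u : V -> R).

Definition sqnorm f : \bar R :=
  \esum_(v in [set: V]) (Normc.normc (f v) ^+ 2 * m v)%:E.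

Definition ell2 : set (V -> R[i]) := [set f | (sqnorm f < +oo)%E].

(* Unconditional sum of an absolutely summable real family. *)
Definition rsum u : R :=
  fine (\esum_(v in [set: V]) ((EFin \o u)^\+ v)
        - \esum_(v in [set: V]) ((EFin \o u)^\- v))%E.

Definition inner f g : R[i] :=
  let p v := f v * (g v)^* * (m v)%:C in
  rsum (fun v => complex.Re (p v)) +i* rsum (fun v => complex.Im (p v)).

(* Operators with a possibly proper domain are represented by their graphs:
   T (f, w) means that f is in the domain of T and T f = w. *)
Definition operator := set ((V -> R[i]) * (V -> R[i])).

(* The Friedrichs extension of a densely defined nonnegative symmetric operator
   A with domain D: the operator associated with the closure of the form
   (f, g) |-> inner (A f) g on D. *)
Section Friedrichs.
Variables (D : set (V -> R[i])) (A : (V -> R[i]) -> V -> R[i]).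

(* F n tends to f in ell^2 and is Cauchy for the form, whose diagonal values
   are real and nonnegative. *)
Definition form_cvg (F : nat -> V -> R[i]) f : Prop :=
  [/\ forall n, D (F n),
      (fun n => sqnorm (F n \- f)) @ \oo --> 0%E &
      forall eps : R, 0 < eps -> exists N, forall i j, (N <= i)%N -> (N <= j)%N ->
        complex.Re (inner (A (F i \- F j)) (F i \- F j)) < eps].

Definition form_dom : set (V -> R[i]) :=
  [set f | ell2 f /\ exists F, form_cvg F f].

(* The value of the closed form at (f, g) is z.  The form is closable, so the
   approximating sequences do not matter. *)
Definition form_closure f g (z : R[i]) : Prop :=
  exists F G, [/\ form_cvg F f, form_cvg G g &
    (fun n => inner (A (F n)) (G n) : R[i]^o) @ \oo --> (z : R[i]^o)].

Definition friedrichs : operator :=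
  [set fw | [/\ form_dom fw.1, ell2 fw.2 &
     forall g, form_dom g -> form_closure fw.1 g (inner fw.2 g)]].

End Friedrichs.

Section Spectrum.
Variable T : operator.

Definition resolvent_set : set R[i] :=
  [set z | (forall g, ell2 g ->
              exists! f, exists2 w, T (f, w) & w \- (z \*o f) = g) /\
           exists c : R, forall f w, T (f, w) ->
              (sqnorm f <= c%:E * sqnorm (w \- (z \*o f))%R)%E].

Definition spectrum : set R[i] := ~` resolvent_set.

Definition eigenspace (z : R[i]) : set (V -> R[i]) :=
  [set f | T (f, z \*o f)].

Definition finite_dim (E : set (V -> R[i])) : Prop :=
  exists n (e : 'I_n -> V -> R[i]), forall f, E f ->
    exists c : 'I_n -> R[i], forall v, f v = \sum_(i < n) c i * e i v.

Definition discrete_spectrum : set R[i] :=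
  [set z | [/\ isolated (spectrum : set R[i]^o) z,
               exists2 f, eigenspace z f & exists v, f v != 0 &
               finite_dim (eigenspace z)]].

Definition essential_spectrum : set R[i] := spectrum `\` discrete_spectrum.

End Spectrum.

End L2.

(* Spectra are subsets of R[i]; for a self-adjoint operator they are real, and
   Re only forgets the zero imaginary part.  The infimum of set0 is +oo. *)
Definition inf_spec (R : realType) (S : set R[i]) : \bar R :=
  ereal_inf [set (complex.Re z)%:E | z in S].

Section Laplacian.
Variables (R : realType) (V : choiceType).
Variables (adj : rel V) (m : V -> R) (b : V -> V -> R).

Definition fin_supp : set (V -> R[i]) :=
  [set f | finite_set [set v | f v != 0]].

Definition tau (f : V -> R[i]) : V -> R[i] := fun v =>
  ((m v)^-1)%:C * \sum_(u \in [set u | adj u v]) ((b u v)%:C * (f v - f u)).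

Definition laplacian : operator R V := friedrichs m fin_supp tau.

Definition lambda0 : \bar R := inf_spec (spectrum m laplacian).

Definition lambda0_ess : \bar R := inf_spec (essential_spectrum m laplacian).

End Laplacian.

(* Main.v *)
Require Import Defs.
From mathcomp Require Import all_boot all_order all_algebra finmap complex.
From mathcomp Require Import all_classical all_reals all_analysis.
From mathcomp Require Import ring lra.
Set Implicit Arguments.
Unset Strict Implicit.
Unset Printing Implicit Defensive.
Import Order.TTheory GRing.Theory Num.Theory numFieldNormedType.Exports.
Local Open Scope classical_set_scope.
Local Open Scope ring_scope.
Local Open Scope complex_scope.

(** Cheeger's inequality for the quadratic form [q] comes from the co-area
    formula applied to [|f|^2]: if [f] is finitely supported in [U] and
    [a <= alpha_d(U)], then
    [a ||f||^2 <= sum_e d(e) b(e) | |f(u)|^2 - |f(v)|^2 |], and the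
    arithmetic-geometric mean inequality together with intrinsicness of [d]
    bounds the right-hand side by [q(f)/a + (a/2) ||f||^2].

    For the spectral statement, let [l < a^2/2] with [a <= alpha_d(V \ X)] and
    [X] finite.  Cutting off on [X] gives [q + c 1_X >= l] for some [c >= 0], so
    [h + c 1_X - z] is boundedly invertible for [Re z < l]: for real [z] the
    solution minimizes an energy functional over finitely supported functions,
    and complex [z] are reached by a contraction around a very negative real
    point.  Removing [c 1_X] is a finite-rank problem, so [z] either lies in the
    resolvent set or is an eigenvalue of [h].  Linear combinations of
    eigenfunctions that vanish on [X] must vanish, which leaves at most [#|X|]
    spectral points below [l], each with a finite-dimensional eigenspace; for
    empty [X] there are none. *)

(** * Semi-inner products *)

(** The spectrum is a set of complex numbers defined by bounded invertibility alone, so a bound on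
    real parts needs resolvents on a whole half-plane; solving for real parameters does not suffice.
    All pairings are kept real: [dot f g] is the real part of the complex inner product, whose
    imaginary part is recovered by testing against [i g], so complex functions are treated as a real
    space with semi-inner products. The closed form is not constructed as a function on its domain:
    its elements are reached through finitely supported approximants, and Green's formula, which
    asks for finite support in one argument only, carries identities to the limit. It also shows
    that the Friedrichs extension acts by the pointwise formula [tau], so that operator equations
    can be verified vertex by vertex. *)

Section SemiInner.
Variables (R : realType) (E : zmodType) (sc : R -> E -> E).
Variables (S : set E) (B : E -> E -> R).

(** One interface serves three real forms: [dot] on square-summable functions, and [qform] and
    [sform] on finitely supported ones. The axioms are relative to [S] because these forms are total
    functions whose bilinearity and symmetry hold only on such a domain. *)
Record semi_inner : Prop := SemiInner {
  si_in : forall a f g, S f -> S g -> S (f + sc a g);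
  si_sc1 : forall f, sc 1 f = f;
  si_scN1 : forall f, sc (-1) f = - f;
  si_lin : forall a f g h, S f -> S g -> S h ->
    B (f + sc a g) h = B f h + a * B g h;
  si_sym : forall f g, S f -> S g -> B f g = B g f;
  si_ge0 : forall f, S f -> 0 <= B f f }.

Hypothesis H : semi_inner.

Lemma si_inD f g : S f -> S g -> S (f + g).
Proof. by move=> Sf Sg; rewrite -(si_sc1 H g); exact: si_in. Qed.

Lemma si_inB f g : S f -> S g -> S (f - g).
Proof. by move=> Sf Sg; rewrite -(si_scN1 H g); exact: si_in. Qed.

Lemma si_Dl f g h : S f -> S g -> S h -> B (f + g) h = B f h + B g h.
Proof. by move=> *; rewrite -{1}(si_sc1 H g) si_lin// mul1r. Qed.

Lemma si_Bl f g h : S f -> S g -> S h -> B (f - g) h = B f h - B g h.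
Proof. by move=> *; rewrite -(si_scN1 H g) si_lin// mulN1r. Qed.

Lemma si_Dr f g h : S f -> S g -> S h -> B h (f + g) = B h f + B h g.
Proof.
by move=> *; rewrite si_sym ?si_Dl//; [congr (_ + _)| exact: si_inD]; apply: si_sym.
Qed.

Lemma si_Br f g h : S f -> S g -> S h -> B h (f - g) = B h f - B h g.
Proof.
by move=> *; rewrite si_sym ?si_Bl//; [congr (_ - _)| exact: si_inB]; apply: si_sym.
Qed.

Lemma si_sqrD f g : S f -> S g -> B (f + g) (f + g) = B f f + 2 * B f g + B g g.
Proof.
move=> Sf Sg; have Sfg := si_inD Sf Sg.
by rewrite si_Dl// !si_Dr// (si_sym H Sg Sf); ring.
Qed.

Lemma si_sqrB f g : S f -> S g -> B (f - g) (f - g) = B f f - 2 * B f g + B g g.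
Proof.
move=> Sf Sg; have Sfg := si_inB Sf Sg.
by rewrite si_Bl// !si_Br// (si_sym H Sg Sf); ring.
Qed.

Lemma si_sqr_lin a f g : S f -> S g ->
  B (f + sc a g) (f + sc a g) = B f f + 2 * a * B f g + a ^+ 2 * B g g.
Proof.
move=> Sf Sg; have Sfg := si_in H a Sf Sg.
rewrite si_lin// (si_sym H Sf)// (si_sym H Sg)// !si_lin//.
by rewrite (si_sym H Sg Sf); ring.
Qed.

Lemma si_CS f g : S f -> S g -> B f g ^+ 2 <= B f f * B g g.
Proof.
move=> Sf Sg; have := si_ge0 H Sg; rewrite le_eqVlt => /predU1P[g0|g0].
  have bnd a : 0 <= B f f + 2 * a * B f g.
    have := si_ge0 H (si_in H a Sf Sg).
    by rewrite si_sqr_lin// -g0 mulr0 addr0.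
  have [->|fg0] := eqVneq (B f g) 0; first by rewrite expr0n -g0 mulr0.
  (* This value of [a] makes the affine function of [a] equal to [-1]. *)
  have := bnd (- (B f f + 1) / (2 * B f g)).
  rewrite [X in _ + X](_ : _ = - (B f f + 1)); first by lra.
  by field.
(* The coefficient minimizes the quadratic function [a |-> B (f + sc a g) (f + sc a g)]. *)
have := si_ge0 H (si_in H (- B f g / B g g) Sf Sg).
rewrite si_sqr_lin// => h0.
have : 0 <= B g g * (B f f + 2 * (- B f g / B g g) * B f g +
       (- B f g / B g g) ^+ 2 * B g g) by rewrite mulr_ge0// ltW.
rewrite [X in 0 <= X](_ : _ = B f f * B g g - B f g ^+ 2) ?subr_ge0//.
by field; rewrite gt_eqF.
Qed.

Lemma si_abs_le f g : S f -> S g ->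
  `|B f g| <= Num.sqrt (B f f) * Num.sqrt (B g g).
Proof.
move=> Sf Sg; rewrite -sqrtrM ?si_ge0// -sqrtr_sqr ler_wsqrtr//.
exact: si_CS.
Qed.

Lemma si_sqrt_D f g : S f -> S g ->
  Num.sqrt (B (f + g) (f + g)) <= Num.sqrt (B f f) + Num.sqrt (B g g).
Proof.
move=> Sf Sg; rewrite -(ler_pXn2r (n := 2)) ?nnegrE ?sqrtr_ge0 ?addr_ge0 ?sqrtr_ge0//.
rewrite sqr_sqrtr ?si_ge0 //; last exact: si_inD.
have := si_abs_le Sf Sg; have := ler_norm (B f g).
rewrite si_sqrD// sqrrD !sqr_sqrtr ?si_ge0// => h1 h2.
have := le_trans h1 h2; lra.
Qed.

Lemma si_sqrt_B f g : S f -> S g ->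
  Num.sqrt (B (f - g) (f - g)) <= Num.sqrt (B f f) + Num.sqrt (B g g).
Proof.
move=> Sf Sg; rewrite -(ler_pXn2r (n := 2)) ?nnegrE ?sqrtr_ge0 ?addr_ge0 ?sqrtr_ge0//.
rewrite sqr_sqrtr ?si_ge0 //; last exact: si_inB.
have := si_abs_le Sf Sg; have := ler_norm (- B f g); rewrite normrN.
rewrite si_sqrB// sqrrD !sqr_sqrtr ?si_ge0// => h1 h2.
have := le_trans h1 h2; lra.
Qed.

(** Nonnegativity at [f + e^-1 g], multiplied by [e], bounds the cross term. The free [e] brings the
    coefficient of [B f f] as close to 1 as desired. *)
Lemma si_sqrB_le (e : R) f g : 0 < e -> S f -> S g ->
  B (f - g) (f - g) <= (1 + e) * B f f + (1 + e^-1) * B g g.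
Proof.
move=> e0 Sf Sg; have := si_ge0 H (si_in H (e^-1) Sf Sg).
rewrite si_sqrB// si_sqr_lin// => /(mulr_ge0 (ltW e0)).
rewrite [X in 0 <= X -> _](_ : _ = e * B f f + 2 * B f g + e^-1 * B g g).
  by lra.
by field; rewrite gt_eqF.
Qed.

End SemiInner.

(** * Unconditional sums and weighted square-summable functions *)

Section RSum.
Variables (R : realType) (V : choiceType).
Implicit Types (u v p : V -> R).

Definition rsummable u := summable [set: V] (EFin \o u).

Lemma rsummableD u v : rsummable u -> rsummable v -> rsummable (fun x => u x + v x).
Proof. exact: summableD. Qed.

Lemma rsummable_le u v : (forall x, `|u x| <= `|v x|) -> rsummable v -> rsummable u.
Proof.
move=> uv; apply: le_lt_trans; apply: le_esum => x _ /=.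
by rewrite lee_fin.
Qed.

Lemma rsummableZ a u : rsummable u -> rsummable (fun x => a * u x).
Proof.
rewrite /rsummable /summable => su.
apply: (@le_lt_trans _ _ (`|a|%:E * \esum_(x in [set: V]) `|(EFin \o u) x|)%E).
  apply: ge_ereal_sup => _ [A [fA _] <-].
  apply: (@le_trans _ _ (`|a|%:E * \sum_(x \in A) `|(EFin \o u) x|)%E).
    rewrite !fsbig_finite//= !sumEFin -EFinM lee_fin mulr_sumr.
    by apply: ler_sum => x _; rewrite normrM.
  apply: lee_wpmul2l; first by rewrite lee_fin.
  by apply: ereal_sup_ubound; exists A.
by rewrite lte_mul_pinfty// lee_fin.
Qed.

(** [rsum] is built from positive and negative parts, which do not add up under addition;
    independence of the chosen nonnegative decomposition avoids a discussion of signs. *)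
Lemma rsum_split u p q : (forall x, u x = p x - q x) ->
  (forall x, 0 <= p x) -> (forall x, 0 <= q x) -> rsummable p -> rsummable q ->
  rsum u = fine (\esum_(x in [set: V]) (p x)%:E) -
           fine (\esum_(x in [set: V]) (q x)%:E).
Proof.
move=> upq p0 q0 sp sq.
have -> : u = p \- q by apply/funext => x; rewrite upq.
rewrite /rsum (_ : EFin \o (p \- q)%R = (EFin \o p) \- (EFin \o q))%E//.
have fn r : (forall x, 0 <= r x) -> rsummable r ->
    (\esum_(x in [set: V]) (r x)%:E)%E \is a fin_num.
  move=> r0; rewrite /rsummable summableE.
  by under eq_esum do rewrite /= ger0_norm//.
rewrite esumB //; [|by move=> x _; rewrite lee_fin..].
by rewrite fineB// fn.
Qed.

Lemma esum_fin p : (forall x, 0 <= p x) -> rsummable p ->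
  (\esum_(x in [set: V]) (p x)%:E)%E \is a fin_num.
Proof.
move=> r0; rewrite /rsummable summableE.
by under eq_esum do rewrite /= ger0_norm//.
Qed.

Lemma rsummable_ge0 p : (forall x, 0 <= p x) ->
  (\esum_(x in [set: V]) (p x)%:E < +oo)%E -> rsummable p.
Proof.
move=> p0; rewrite /rsummable /summable.
by under [X in _ -> (X < _)%E]eq_esum do rewrite /= ger0_norm//.
Qed.

Lemma rsum_pos p : (forall x, 0 <= p x) -> rsummable p ->
  rsum p = fine (\esum_(x in [set: V]) (p x)%:E).
Proof.
move=> p0 sp; rewrite (@rsum_split p p (fun=> 0))//.
- by rewrite (esum1 (a := fun=> 0%:E))//= subr0.
- by move=> x; rewrite subr0.
- by apply: rsummable_le sp => x; rewrite normr0.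
Qed.

Let pos u x := Num.max (u x) 0.
Let neg u x := Num.max (- u x) 0.

Let pos_ge0 u x : 0 <= pos u x.
Proof. by rewrite /pos le_max lexx orbT. Qed.
Let neg_ge0 u x : 0 <= neg u x.
Proof. by rewrite /neg le_max lexx orbT. Qed.
Let posneg u x : u x = pos u x - neg u x.
Proof. by rewrite /pos /neg /Num.max; do 2 case: ifP; lra. Qed.
Let pos_le u x : `|pos u x| <= `|u x|.
Proof. by rewrite /pos /Num.max; case: ifP => // _; rewrite normr0. Qed.
Let neg_le u x : `|neg u x| <= `|u x|.
Proof. by rewrite /neg /Num.max; case: ifP => // _; rewrite ?normr0 ?normrN. Qed.

Lemma rsumD u v : rsummable u -> rsummable v ->
  rsum (fun x => u x + v x) = rsum u + rsum v.
Proof.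
move=> su sv.
have spu := rsummable_le (pos_le u) su; have snu := rsummable_le (neg_le u) su.
have spv := rsummable_le (pos_le v) sv; have snv := rsummable_le (neg_le v) sv.
rewrite (@rsum_split _ (fun x => pos u x + pos v x) (fun x => neg u x + neg v x)).
- rewrite (rsum_split (posneg u))// (rsum_split (posneg v))//.
  under eq_esum do rewrite EFinD.
  rewrite esumD//; last 2 first.
    by move=> x _; rewrite lee_fin.
    by move=> x _; rewrite lee_fin.
  under [X in _ - fine X]eq_esum do rewrite EFinD.
  rewrite esumD//; last 2 first.
    by move=> x _; rewrite lee_fin.
    by move=> x _; rewrite lee_fin.
  by rewrite !fineD ?esum_fin//; ring.
- by move=> x; rewrite {1}(posneg u) {1}(posneg v); ring.
- by move=> x; rewrite addr_ge0.
- by move=> x; rewrite addr_ge0.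
- exact: rsummableD.
- exact: rsummableD.
Qed.

Lemma esumZ a p : 0 <= a -> (forall x, 0 <= p x) -> rsummable p ->
  fine (\esum_(x in [set: V]) (a * p x)%:E) =
  a * fine (\esum_(x in [set: V]) (p x)%:E).
Proof.
move=> a0 p0 sp.
have le c r : 0 <= c -> (forall x, 0 <= r x) -> rsummable r ->
    fine (\esum_(x in [set: V]) (c * r x)%:E) <=
    c * fine (\esum_(x in [set: V]) (r x)%:E).
  move=> c0 r0 sr.
  rewrite -lee_fin EFinM !fineK ?esum_fin//; last 2 first.
    by move=> x; rewrite mulr_ge0.
    exact: rsummableZ.
  apply: ge_ereal_sup => _ [A [fA _] <-].
  apply: (@le_trans _ _ (c%:E * \sum_(x \in A) (r x)%:E)%E).
    by rewrite !fsbig_finite//= !sumEFin -EFinM lee_fin mulr_sumr.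
  apply: lee_wpmul2l; first by rewrite lee_fin.
  by apply: ereal_sup_ubound; exists A.
apply/eqP; rewrite eq_le le//=.
have [->|an0] := eqVneq a 0.
  by rewrite mul0r fine_ge0// esum_ge0// => x _; rewrite lee_fin mul0r.
have ap : 0 < a by rewrite lt_def an0.
(* The converse inequality is [le] again, for the factor [a^-1] and the family [a * p x]. *)
rewrite -ler_pdivlMl//.
rewrite [X in fine X <= _](_ : _ = \esum_(x in [set: V]) (a^-1 * (a * p x))%:E)%E.
  by apply: le; [rewrite invr_ge0| move=> x; rewrite mulr_ge0|exact: rsummableZ].
by apply: eq_esum => x _; rewrite mulKf.
Qed.

Lemma rsumZ a u : rsummable u -> rsum (fun x => a * u x) = a * rsum u.
Proof.
move=> su.
have spu := rsummable_le (pos_le u) su; have snu := rsummable_le (neg_le u) su.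
have [a0|a0] := leP 0 a.
  rewrite (@rsum_split _ (fun x => a * pos u x) (fun x => a * neg u x)).
  - rewrite (rsum_split (posneg u))// mulrBr.
    by rewrite (esumZ a0 (pos_ge0 u) spu) (esumZ a0 (neg_ge0 u) snu).
  - by move=> x; rewrite {1}(posneg u); ring.
  - by move=> x; rewrite mulr_ge0.
  - by move=> x; rewrite mulr_ge0.
  - exact: rsummableZ.
  - exact: rsummableZ.
have Na0 : 0 <= - a by rewrite oppr_ge0 ltW.
rewrite (@rsum_split _ (fun x => - a * neg u x) (fun x => - a * pos u x)).
- rewrite (rsum_split (posneg u))//.
  by rewrite (esumZ Na0 (pos_ge0 u) spu) (esumZ Na0 (neg_ge0 u) snu); ring.
- by move=> x; rewrite {1}(posneg u); ring.
- by move=> x; rewrite mulr_ge0.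
- by move=> x; rewrite mulr_ge0.
- exact: rsummableZ.
- exact: rsummableZ.
Qed.

Lemma rsummable_finite u : finite_set [set x | u x != 0] -> rsummable u.
Proof.
move=> fu; rewrite /rsummable /summable.
suff -> : (\esum_(x in [set: V]) `|(EFin \o u) x|)%E =
   (\sum_(x \in [set x | (u x != 0)%R]) `|(EFin \o u) x|)%E.
  by rewrite fsbig_finite//= sumEFin ltry.
rewrite -esum_fset// [RHS]esum_mkcond; apply: eq_esum => x _.
by case: ifPn => //; rewrite notin_setE/= => /negP; rewrite negbK => /eqP ->; rewrite normr0.
Qed.

Lemma rsum_finite u : finite_set [set x | u x != 0] ->
  rsum u = \sum_(x \in [set x | u x != 0]) u x.
Proof.
move=> fu.
have pf p : (forall x, 0 <= p x) -> (forall x, `|p x| <= `|u x|) ->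
    fine (\esum_(x in [set: V]) (p x)%:E) = \sum_(x \in [set x | u x != 0]) p x.
  move=> p0 pu.
  suff -> : (\esum_(x in [set: V]) (p x)%:E)%E =
     (\sum_(x \in [set x | (u x != 0)%R]) (p x)%:E)%E.
    by rewrite !fsbig_finite//= sumEFin.
  rewrite -esum_fset//; last by move=> x _; rewrite lee_fin.
  rewrite [RHS]esum_mkcond; apply: eq_esum => x _.
  case: ifPn => //; rewrite notin_setE/= => /negP; rewrite negbK => /eqP u0.
  by have := pu x; rewrite u0 normr0 normr_le0 => /eqP ->.
rewrite (rsum_split (posneg u))//; last 2 first.
  exact/(rsummable_le (pos_le u))/rsummable_finite.
  exact/(rsummable_le (neg_le u))/rsummable_finite.
rewrite !pf// !fsbig_finite//= -sumrB.
by apply: eq_bigr => x _; rewrite -posneg.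
Qed.

End RSum.

(** * Limits of real sequences *)

Section RealSequences.
Variable R : realType.
Implicit Types (u v : nat -> R) (l c : R).

Lemma cvgn_epsP u l : u @ \oo --> l <->
  forall e, 0 < e -> exists N, forall n, (N <= n)%N -> `|u n - l| < e.
Proof.
split=> [/cvgrPdist_lt h e e0|h].
  have [N _ hN] := h _ e0; exists N => n Nn.
  by rewrite distrC; apply: hN.
apply/cvgrPdist_lt => e e0; have [N hN] := h _ e0.
by exists N => // n /= Nn; rewrite distrC; exact: hN.
Qed.

Lemma cvg_ge u l c N : u @ \oo --> l -> (forall n, (N <= n)%N -> c <= u n) -> c <= l.
Proof.
move=> ul h; rewrite leNgt; apply/negP => lc.
have /cvgn_epsP/(_ (c - l)) [|M hM] := ul; first by rewrite subr_gt0.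
have := hM (maxn N M) (leq_maxr _ _); have := h (maxn N M) (leq_maxl _ _).
have := ler_norm (u (maxn N M) - l); lra.
Qed.

Lemma cvg_le u l c N : u @ \oo --> l -> (forall n, (N <= n)%N -> u n <= c) -> l <= c.
Proof.
move=> ul h; have : - c <= - l; last by rewrite lerN2.
by apply: (@cvg_ge (- u) _ _ N); [exact: cvgN|move=> n /h; rewrite lerN2].
Qed.

Lemma cauchy_cvgn u :
  (forall e, 0 < e -> exists N, forall i j, (N <= i)%N -> (N <= j)%N ->
    `|u i - u j| < e) -> exists l, u @ \oo --> l.
Proof.
move=> h; suff : cvg (u @ \oo) by move=> ul; exists (lim (u @ \oo)).
apply: cauchy_cvg; apply/cauchyP => e e0; have [N hN] := h _ e0.
exists (u N), N => // n /= Nn; exact: hN.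
Qed.

Lemma cvg_sumr (I : Type) (r : seq I) (u : I -> nat -> R) (l : I -> R) :
  (forall i, u i @ \oo --> l i) ->
  (fun n => \sum_(i <- r) u i n) @ \oo --> \sum_(i <- r) l i.
Proof.
move=> h; elim: r => [|i r IH].
  rewrite big_nil (_ : (fun n => _) = fun=> 0); first exact: cvg_cst.
  by apply/funext => n; rewrite big_nil.
rewrite big_cons (_ : (fun n => _) = u i + (fun n => \sum_(j <- r) u j n)).
  by apply: cvgD.
by apply/funext => n; rewrite big_cons.
Qed.

Lemma cvg_le_cvg0 u v : (forall n, `|u n| <= v n) -> v @ \oo --> (0 : R) ->
  u @ \oo --> (0 : R).
Proof.
move=> uv /cvgn_epsP v0; apply/cvgn_epsP => e e0; have [N hN] := v0 _ e0.
exists N => n /hN; rewrite !subr0; apply: le_lt_trans.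
exact: le_trans (uv n) (ler_norm _).
Qed.

Lemma cvg_sub0 u l : (fun n => u n - l) @ \oo --> (0 : R) <-> u @ \oo --> l.
Proof.
by split=> /cvgn_epsP h; apply/cvgn_epsP => e /h[N hN]; exists N => n /hN; rewrite subr0.
Qed.

Lemma cvg_sqrt0 u : u @ \oo --> (0 : R) -> (fun n => Num.sqrt (u n)) @ \oo --> (0 : R).
Proof.
move=> /cvgn_epsP h; apply/cvgn_epsP => e e0.
have [|N hN] := h (e ^+ 2); first by rewrite exprn_gt0.
exists N => n /hN; rewrite !subr0 => ue; rewrite ger0_norm ?sqrtr_ge0//.
rewrite -(ltr_pXn2r (n := 2)) ?nnegrE ?sqrtr_ge0 ?ltW//.
have [u0|u0] := leP 0 (u n).
  by rewrite sqr_sqrtr //; exact: le_lt_trans (ler_norm _) ue.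
by rewrite (ler0_sqrtr (ltW u0)) expr0n/= exprn_gt0.
Qed.

Lemma cvg_bounded0 u v c : (forall n, `|u n| <= c) -> v @ \oo --> (0 : R) ->
  (fun n => u n * v n) @ \oo --> (0 : R).
Proof.
move=> uc v0; apply: (@cvg_le_cvg0 _ (fun n => c * `|v n|)) => [n|].
  by rewrite normrM ler_wpM2r.
have : (fun n => c * `|v n|) @ \oo --> c * `|0 : R|.
  by apply: cvgM; [exact: cvg_cst|exact: cvg_norm].
by rewrite normr0 mulr0.
Qed.

Lemma cvg_ext u v l : (forall n, u n = v n) -> v @ \oo --> l -> u @ \oo --> l.
Proof. by move=> /funext ->. Qed.

End RealSequences.

(** * The real inner product on the complex plane *)

Section ComplexDot.
Variable R : realType.
Implicit Types (x y z : R[i]) (a : R).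

(** This is the real part of [x * y^*]. *)
Definition cdot x y : R := complex.Re x * complex.Re y + complex.Im x * complex.Im y.

Lemma normc_sqr x : Normc.normc x ^+ 2 = cdot x x.
Proof. by case: x => a b; rewrite /= sqr_sqrtr ?addr_ge0 ?sqr_ge0// !expr2. Qed.

Lemma cdot_ge0 x : 0 <= cdot x x.
Proof. by rewrite -normc_sqr sqr_ge0. Qed.

Lemma cdot_eq0 x : cdot x x = 0 -> x = 0.
Proof.
rewrite -normc_sqr => /eqP; rewrite expf_eq0/= => /eqP; exact: Normc.eq0_normc.
Qed.

Lemma cdotC x y : cdot x y = cdot y x.
Proof. by case: x y => [a b] [c d]; rewrite /cdot /=; ring. Qed.

Lemma cdot_lin a x y z : cdot (x + a%:C * y) z = cdot x z + a * cdot y z.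
Proof. by case: x y z => [x1 x2] [y1 y2] [z1 z2]; rewrite /cdot /=; ring. Qed.

Lemma cdotDl x y z : cdot (x + y) z = cdot x z + cdot y z.
Proof. by case: x y z => [x1 x2] [y1 y2] [z1 z2]; rewrite /cdot /=; ring. Qed.

Lemma cdotNl x z : cdot (- x) z = - cdot x z.
Proof. by case: x z => [x1 x2] [z1 z2]; rewrite /cdot /=; ring. Qed.

Lemma cdot0l z : cdot 0 z = 0.
Proof. by case: z => [z1 z2]; rewrite /cdot /=; ring. Qed.

Lemma cdotBl x y z : cdot (x - y) z = cdot x z - cdot y z.
Proof. by rewrite cdotDl cdotNl. Qed.

Lemma cdotZl a y z : cdot (a%:C * y) z = a * cdot y z.
Proof. by case: y z => [y1 y2] [z1 z2]; rewrite /cdot /=; ring. Qed.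

Lemma cdotM z x y : cdot (z * x) (z * y) = cdot z z * cdot x y.
Proof. by case: x y z => [x1 x2] [y1 y2] [z1 z2]; rewrite /cdot /=; ring. Qed.

Lemma cdot_conj z x y : cdot (z * x) y = cdot x (z^* * y).
Proof. by case: x y z => [x1 x2] [y1 y2] [z1 z2]; rewrite /cdot /=; ring. Qed.

Lemma cdot_mulE z x : cdot (z * x) x = complex.Re z * cdot x x.
Proof. by case: x z => [x1 x2] [z1 z2]; rewrite /cdot /=; ring. Qed.

Lemma cdot_suml (I : Type) (r : seq I) (F : I -> R[i]) z :
  cdot (\sum_(i <- r) F i) z = \sum_(i <- r) cdot (F i) z.
Proof.
elim: r => [|i r IH]; first by rewrite !big_nil cdot0l.
by rewrite !big_cons cdotDl IH.
Qed.

Lemma cdot_le x y : `|cdot x y| <= cdot x x + cdot y y.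
Proof.
case: x y => [x1 x2] [y1 y2]; rewrite /cdot /= ler_norml.
have h1 := sqr_ge0 (x1 - y1); have h2 := sqr_ge0 (x2 - y2).
have h3 := sqr_ge0 (x1 + y1); have h4 := sqr_ge0 (x2 + y2).
have h5 := sqr_ge0 x1; have h6 := sqr_ge0 x2.
have h7 := sqr_ge0 y1; have h8 := sqr_ge0 y2.
by apply/andP; split; nra.
Qed.

Lemma cdotD_le2 x y : cdot (x - y) (x - y) <= 2 * (cdot x x + cdot y y).
Proof.
case: x y => [x1 x2] [y1 y2]; rewrite /cdot /=.
have h3 := sqr_ge0 (x1 + y1); have h4 := sqr_ge0 (x2 + y2).
by nra.
Qed.

Lemma Re_le_normc z : `|complex.Re z| <= Normc.normc z.
Proof.
by case: z => a b /=; rewrite -sqrtr_sqr ler_wsqrtr// lerDl sqr_ge0.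
Qed.

Lemma Im_le_normc z : `|complex.Im z| <= Normc.normc z.
Proof.
by case: z => a b /=; rewrite -sqrtr_sqr ler_wsqrtr// lerDr sqr_ge0.
Qed.

Lemma ReB (x y : R[i]) : complex.Re (x - y) = complex.Re x - complex.Re y.
Proof. by case: x y => [? ?] [? ?]. Qed.

Lemma ImB (x y : R[i]) : complex.Im (x - y) = complex.Im x - complex.Im y.
Proof. by case: x y => [? ?] [? ?]. Qed.

End ComplexDot.

(** * The weighted Hilbert space as a real space *)

Section Ell2.
Variables (R : realType) (V : choiceType) (m : V -> R).
Hypothesis m_gt0 : forall v, 0 < m v.
Implicit Types (f g h : V -> R[i]) (a : R) (z : R[i]) (S : {fset V}).

Definition rscale a f : V -> R[i] := a%:C \*o f.

Definition dot f g : R := rsum (fun v => cdot (f v) (g v) * m v).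

Definition nrm f : R := Num.sqrt (dot f f).

Lemma cdotm_ge0 f v : 0 <= cdot (f v) (f v) * m v.
Proof. by rewrite mulr_ge0 ?cdot_ge0// ltW. Qed.
Hint Resolve cdotm_ge0 : core.

Lemma sqnorm_esum f :
  sqnorm m f = \esum_(v in [set: V]) (cdot (f v) (f v) * m v)%:E.
Proof. by apply: eq_esum => v _; rewrite normc_sqr. Qed.

Lemma ell2P f : ell2 m f <-> rsummable (fun v => cdot (f v) (f v) * m v).
Proof.
rewrite /ell2 /= sqnorm_esum; split; first exact: rsummable_ge0.
by move=> /esum_fin; rewrite fin_numElt => /(_ _)/andP[].
Qed.

Lemma dot_esum f : ell2 m f ->
  (dot f f)%:E = \esum_(v in [set: V]) (cdot (f v) (f v) * m v)%:E.
Proof. by move=> /ell2P f2; rewrite /dot rsum_pos// fineK// esum_fin. Qed.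

Lemma sqnormE f : ell2 m f -> sqnorm m f = (dot f f)%:E.
Proof. by move=> f2; rewrite dot_esum// sqnorm_esum. Qed.

Lemma rsummable_cdot f g : ell2 m f -> ell2 m g ->
  rsummable (fun v => cdot (f v) (g v) * m v).
Proof.
move=> /ell2P f2 /ell2P g2; apply: rsummable_le (rsummableD f2 g2) => v.
rewrite -mulrDl !normrM ler_wpM2r//.
by rewrite [leRHS]ger0_norm ?cdot_le// addr_ge0 ?cdot_ge0.
Qed.

Lemma ell2M z f : ell2 m f -> ell2 m (z \*o f).
Proof.
move=> /ell2P /(rsummableZ (cdot z z)) f2; apply/ell2P.
by apply: rsummable_le f2 => v /=; rewrite cdotM mulrA.
Qed.

Lemma ell2B f g : ell2 m f -> ell2 m g -> ell2 m (f - g).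
Proof.
move=> /ell2P f2 /ell2P g2; apply/ell2P.
apply: rsummable_le (rsummableZ 2 (rsummableD f2 g2)) => v /=.
rewrite ger0_norm// ger0_norm ?mulr_ge0 ?addr_ge0//.
by rewrite -mulrDl mulrA ler_wpM2r ?cdotD_le2// ltW.
Qed.

Lemma ell2N f : ell2 m f -> ell2 m (- f).
Proof.
move=> f2; rewrite (_ : - f = (-1) \*o f); first exact: ell2M.
by apply/funext => v; rewrite /= mulN1r.
Qed.

Lemma ell2D f g : ell2 m f -> ell2 m g -> ell2 m (f + g).
Proof. by move=> f2 g2; rewrite -[g]opprK; apply: ell2B => //; exact: ell2N. Qed.

Lemma ell20 : ell2 m 0.
Proof.
apply/ell2P/rsummable_finite; rewrite (_ : [set _ | _] = set0)//.
by apply/seteqP; split=> // v /=; rewrite cdot0l mul0r eqxx.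
Qed.

Lemma ell2_sum (I : Type) (r : seq I) (F : I -> V -> R[i]) :
  (forall i, ell2 m (F i)) -> ell2 m (\sum_(i <- r) F i).
Proof.
by move=> h; elim/big_ind: _ => //; [exact: ell20|move=> x y; exact: ell2D].
Qed.

Lemma dot_semi_inner : semi_inner rscale (ell2 m) dot.
Proof.
split.
- by move=> a f g f2 g2; apply: ell2D => //; exact: ell2M.
- by move=> f; apply/funext => v; rewrite /rscale /= mul1r.
- by move=> f; apply/funext => v; rewrite /rscale /= rmorphN mulN1r.
- move=> a f g h f2 g2 h2.
  rewrite /dot -rsumZ ?rsummable_cdot// -rsumD ?rsummable_cdot//.
    by congr rsum; apply/funext => v; rewrite cdot_lin; ring.
  by apply: rsummableZ; exact: rsummable_cdot.
- by move=> f g _ _; congr rsum; apply/funext => v; rewrite cdotC.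
- by move=> f f2; rewrite -lee_fin dot_esum// esum_ge0// => v _; rewrite lee_fin.
Qed.

Let dsi := dot_semi_inner.

Lemma dotC f g : dot f g = dot g f.
Proof. by congr rsum; apply/funext => v; rewrite cdotC. Qed.

Lemma dot_ge0 f : ell2 m f -> 0 <= dot f f.
Proof. exact: (si_ge0 dsi). Qed.

Lemma dotMM z f g : ell2 m f -> ell2 m g ->
  dot (z \*o f) (z \*o g) = cdot z z * dot f g.
Proof.
move=> f2 g2; rewrite /dot -rsumZ ?rsummable_cdot//.
by congr rsum; apply/funext => v; rewrite /= cdotM; ring.
Qed.

Lemma dotM_self z f : ell2 m f -> dot (z \*o f) f = complex.Re z * dot f f.
Proof.
move=> f2; rewrite /dot -rsumZ ?rsummable_cdot//.
by congr rsum; apply/funext => v; rewrite /= cdot_mulE; ring.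
Qed.

Lemma dotM_conj z f g : dot (z \*o f) g = dot f (z^* \*o g).
Proof. by congr rsum; apply/funext => v; rewrite /= cdot_conj. Qed.

(** Multiplying the second argument by [i] rotates the imaginary part of the pairing into the real
    part, so real pairings determine the complex inner product. *)
Lemma inner_dot f g : inner m f g = dot f g +i* dot f ('i \*o g).
Proof.
by congr (_ +i* _); congr rsum; apply/funext => v /=;
  case: (f v) (g v) => [x1 x2] [y1 y2]; rewrite /cdot /=; ring.
Qed.

Lemma dot_fset f S : ell2 m f -> \sum_(v <- S) cdot (f v) (f v) * m v <= dot f f.
Proof.
move=> f2; rewrite -lee_fin dot_esum//; apply: ereal_sup_ubound.
exists [set` S] => //; rewrite -sumEFin fsbig_finite//=.
by rewrite set_fsetK.
Qed.

Lemma dot_ge_pt f v : ell2 m f -> cdot (f v) (f v) * m v <= dot f f.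
Proof. by move=> /(@dot_fset _ [fset v]%fset); rewrite big_seq_fset1. Qed.

Lemma dot_eq0 f : ell2 m f -> dot f f = 0 -> f = 0.
Proof.
move=> f2 f0; apply/funext => v; apply: cdot_eq0; apply/eqP.
have := dot_ge_pt v f2; rewrite f0 pmulr_lle0// => h.
by rewrite eq_le h cdot_ge0.
Qed.

Lemma dot_finite f g S : (forall v, f v != 0 -> v \in S) ->
  dot f g = \sum_(v <- S) cdot (f v) (g v) * m v.
Proof.
move=> fS.
have sub : [set v | cdot (f v) (g v) * m v != 0] `<=` [set` S].
  move=> v /= h; apply: fS; apply: contraNneq h => ->.
  by rewrite cdot0l mul0r.
rewrite /dot rsum_finite; last exact: sub_finite_set sub _.
apply: fsbig_fwiden => // v [/= _ /negP]; rewrite negbK => /eqP ->//.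
Qed.

Lemma ell2_finite f : finite_set [set v | f v != 0] -> ell2 m f.
Proof.
move=> ff; apply/ell2P/rsummable_finite; apply: sub_finite_set ff => v /=.
by apply: contraNN => /eqP ->; rewrite cdot0l mul0r.
Qed.

Lemma nrm_ge0 f : 0 <= nrm f. Proof. exact: sqrtr_ge0. Qed.

Lemma nrm_sqr f : ell2 m f -> nrm f ^+ 2 = dot f f.
Proof. by move=> f2; rewrite sqr_sqrtr// dot_ge0. Qed.

Lemma nrmD f g : ell2 m f -> ell2 m g -> nrm (f + g) <= nrm f + nrm g.
Proof. exact: (si_sqrt_D dsi). Qed.

Lemma nrmB f g : ell2 m f -> ell2 m g -> nrm (f - g) <= nrm f + nrm g.
Proof. exact: (si_sqrt_B dsi). Qed.

Lemma nrm0 : nrm 0 = 0.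
Proof.
rewrite /nrm (@dot_finite _ _ fset0); last by move=> v; rewrite eqxx.
by rewrite big_seq_fset0 sqrtr0.
Qed.

Lemma nrm_sum (I : Type) (r : seq I) (F : I -> V -> R[i]) :
  (forall i, ell2 m (F i)) -> nrm (\sum_(i <- r) F i) <= \sum_(i <- r) nrm (F i).
Proof.
move=> h; elim: r => [|i r IH]; first by rewrite !big_nil nrm0.
rewrite !big_cons; apply: le_trans (nrmD _ _) _ => //; first exact: ell2_sum.
by rewrite lerD2l.
Qed.

Lemma nrmM z f : ell2 m f -> nrm (z \*o f) = Normc.normc z * nrm f.
Proof.
move=> f2; rewrite /nrm dotMM// -normc_sqr sqrtrM ?sqr_ge0// sqrtr_sqr ger0_norm//.
by case: z => a b /=; rewrite sqrtr_ge0.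
Qed.

Lemma nrm_eq0 f : ell2 m f -> nrm f = 0 -> f = 0.
Proof.
by move=> f2 f0; apply: dot_eq0 => //; rewrite -nrm_sqr// f0 expr0n.
Qed.

(** Point evaluation is bounded because every vertex has positive mass. This gives pointwise limits
    of Cauchy sequences and, later, control of the finite system on [X]. *)
Lemma normc_le_nrm f v : ell2 m f ->
  Normc.normc (f v) <= nrm f / Num.sqrt (m v).
Proof.
move=> f2; rewrite ler_pdivlMr ?sqrtr_gt0//.
rewrite -(ler_pXn2r (n := 2)) ?nnegrE ?nrm_ge0//; last first.
  by rewrite mulr_ge0 ?sqrtr_ge0//; case: (f v) => a b /=; rewrite sqrtr_ge0.
by rewrite exprMn nrm_sqr// sqr_sqrtr ?(ltW (m_gt0 v))// normc_sqr dot_ge_pt.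
Qed.

Lemma dot_le f g : ell2 m f -> ell2 m g -> `|dot f g| <= nrm f * nrm g.
Proof. exact: (si_abs_le dsi). Qed.

Lemma dotDl f g h : ell2 m f -> ell2 m g -> ell2 m h ->
  dot (f + g) h = dot f h + dot g h.
Proof. exact: (si_Dl dsi). Qed.

Lemma dotBl f g h : ell2 m f -> ell2 m g -> ell2 m h ->
  dot (f - g) h = dot f h - dot g h.
Proof. exact: (si_Bl dsi). Qed.

Lemma dotBr f g h : ell2 m f -> ell2 m g -> ell2 m h ->
  dot h (f - g) = dot h f - dot h g.
Proof. exact: (si_Br dsi). Qed.

Lemma dot_suml (I : Type) (r : seq I) (F : I -> V -> R[i]) g :
  (forall i, ell2 m (F i)) -> ell2 m g ->
  dot (\sum_(i <- r) F i) g = \sum_(i <- r) dot (F i) g.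
Proof.
move=> h g2; elim: r => [|i r IH]; last by rewrite !big_cons dotDl ?IH//; exact: ell2_sum.
rewrite !big_nil (@dot_finite _ _ fset0) ?big_seq_fset0//.
by move=> v; rewrite eqxx.
Qed.

Lemma sqnorm_cvg0 (F : nat -> V -> R[i]) : (forall n, ell2 m (F n)) ->
  (fun n => sqnorm m (F n)) @ \oo --> 0%E <->
  (fun n => nrm (F n)) @ \oo --> (0 : R).
Proof.
move=> F2; rewrite (_ : (fun n => sqnorm m (F n)) = EFin \o (fun n => dot (F n) (F n))).
  split=> [/fine_cvg h|h]; first exact: cvg_sqrt0.
  apply/fine_cvgP; split; first exact: nearW.
  apply: (@cvg_ext _ _ (fun n => nrm (F n) * nrm (F n))).
    by move=> n /=; rewrite -expr2 nrm_sqr.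
  have : (fun n => nrm (F n) * nrm (F n)) @ \oo --> (0 : R) * 0 by exact: cvgM.
  by rewrite mulr0.
by apply/funext => n /=; rewrite sqnormE.
Qed.

(* The limit is taken pointwise; Fatou's lemma for finite sums gives the norm
   estimate. *)
Lemma ell2_complete (F : nat -> V -> R[i]) : (forall n, ell2 m (F n)) ->
  (forall e, 0 < e -> exists N, forall i j, (N <= i)%N -> (N <= j)%N ->
     nrm (F i - F j) < e) ->
  exists f, [/\ ell2 m f, (fun n => nrm (F n - f)) @ \oo --> (0 : R) &
    forall v, (fun n => complex.Re (F n v)) @ \oo --> complex.Re (f v) /\
              (fun n => complex.Im (F n v)) @ \oo --> complex.Im (f v)].
Proof.
move=> F2 hF.
have cv (p : R[i] -> R) : (forall x y, p (x - y) = p x - p y) ->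
    (forall x, `|p x| <= Normc.normc x) ->
    forall v, exists l : R, (fun n => p (F n v)) @ \oo --> l.
  move=> pB pn v; apply: cauchy_cvgn => e e0.
  have smv : 0 < Num.sqrt (m v) by rewrite sqrtr_gt0.
  have [|N hN] := hF (e * Num.sqrt (m v)); first by rewrite mulr_gt0.
  exists N => i j Ni Nj; rewrite -pB; apply: le_lt_trans (pn _) _.
  apply: le_lt_trans (normc_le_nrm v (ell2B (F2 i) (F2 j))) _.
  by rewrite ltr_pdivrMr// hN.
have [re hre] := choice (cv _ (@ReB R) (@Re_le_normc R)).
have [im him] := choice (cv _ (@ImB R) (@Im_le_normc R)).
pose f v := re v +i* im v.
have key e : 0 < e -> exists N, forall n, (N <= n)%N -> ell2 m (F n - f) /\ nrm (F n - f) <= e.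
  move=> e0; have [N hN] := hF _ e0; exists N => n Nn.
  have bnd : (\esum_(v in [set: V])
      (cdot ((F n - f) v) ((F n - f) v) * m v)%:E <= (e ^+ 2)%:E)%E.
    apply: ge_ereal_sup => _ [A [fA _] <-].
    rewrite fsbig_finite//= sumEFin lee_fin.
    apply: (@cvg_le _ (fun k => \sum_(v <- fset_set A)
      cdot ((F n - F k) v) ((F n - F k) v) * m v) _ _ N).
      apply: cvg_sumr => v; apply: cvgM; last exact: cvg_cst.
      have c1 : (fun k => complex.Re ((F n - F k) v)) @ \oo --> complex.Re ((F n - f) v).
        apply: (@cvg_ext _ _ ((fun=> complex.Re (F n v)) -
            (fun k => complex.Re (F k v)))) => [k|].
          exact: ReB.
        have -> : complex.Re ((F n - f) v) =
            complex.Re (F n v) - complex.Re (f v) by exact: ReB.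
        by apply: (@cvgB R R nat); [exact: cvg_cst|exact: hre].
      have c2 : (fun k => complex.Im ((F n - F k) v)) @ \oo --> complex.Im ((F n - f) v).
        apply: (@cvg_ext _ _ ((fun=> complex.Im (F n v)) -
            (fun k => complex.Im (F k v)))) => [k|].
          exact: ImB.
        have -> : complex.Im ((F n - f) v) =
            complex.Im (F n v) - complex.Im (f v) by exact: ImB.
        by apply: (@cvgB R R nat); [exact: cvg_cst|exact: him].
      by apply: cvgD; apply: cvgM.
    move=> k Nk; apply: le_trans (dot_fset _ (ell2B (F2 n) (F2 k))) _.
    rewrite -nrm_sqr; last exact: ell2B.
    by rewrite ler_pXn2r ?nnegrE ?nrm_ge0 ?(ltW e0)// ltW// hN.
  have d2 : ell2 m (F n - f).
    by rewrite /ell2 /= sqnorm_esum; apply: le_lt_trans bnd _; rewrite ltry.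
  split=> //; rewrite -(ler_pXn2r (n := 2)) ?nnegrE ?nrm_ge0 ?(ltW e0)//.
  by rewrite nrm_sqr// -lee_fin dot_esum.
exists f; split; last by move=> v; split; [exact: hre|exact: him].
- have [N hN] := key 1 ltr01; have [d2 _] := hN N (leqnn N).
  by rewrite -[f](subKr (F N)); exact: ell2B.
- apply/cvgn_epsP => e e0; have [|N hN] := key (e / 2); first by rewrite divr_gt0.
  exists N => n /hN[_]; rewrite subr0 ger0_norm ?nrm_ge0// => /le_lt_trans; apply.
  by rewrite ltr_pdivrMr// ltr_pMr// ltr1n.
Qed.

End Ell2.

(** * Green's formula *)

Lemma fset2_inj (V : choiceType) (u v u' v' : V) :
  [fset u; v]%fset = [fset u'; v']%fset ->
  (u = u' /\ v = v') \/ (u = v' /\ v = u').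
Proof.
move=> h.
have : u \in [fset u'; v']%fset by rewrite -h fset21.
have : v \in [fset u'; v']%fset by rewrite -h fset22.
have : u' \in [fset u; v]%fset by rewrite h fset21.
have : v' \in [fset u; v]%fset by rewrite h fset22.
move=> /fset2P h1 /fset2P h2 /fset2P h3 /fset2P h4.
case: h4 => [uu'|uv']; case: h3 => [vu'|vv']; [|by left|by right|].
- by left; split=> //; case: h1 => ->//; rewrite uu'.
- by right; split=> //; case: h2 => ->//; rewrite vv'.
Qed.

Lemma fun_addE (T : Type) (A : nmodType) (f g : T -> A) x : (f + g) x = f x + g x.
Proof. by []. Qed.

Lemma fun_oppE (T : Type) (A : zmodType) (f : T -> A) x : (- f) x = - f x.
Proof. by []. Qed.

Lemma fun_mulE (T : Type) (A : pzRingType) (a : A) (f : T -> A) x :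
  (a \*o f) x = a * f x.
Proof. by []. Qed.

Definition funE := (fun_addE, fun_oppE, fun_mulE).

Section Graph.
Variables (R : realType) (V : choiceType) (adj : rel V).
Variables (m : V -> R) (b : V -> V -> R) (d : {fset V} -> R).
Hypotheses (hG : is_graph adj) (hw : is_weight adj m b).
Implicit Types (f g h : V -> R[i]) (a : R) (z : R[i]) (S T : {fset V}) (u v : V).

Let m_gt0 := weight_vertex_gt0 hw.
Let b_ge0 := weight_ge0 hw.
Let b_sym := weight_sym hw.

Lemma weight_nadj u v : ~~ adj u v -> b u v = 0.
Proof. by move=> h; apply/eqP; apply: contraNT h; exact: (weight_support hw). Qed.

Lemma edge_inj v : injective (fun u => [fset u; v]%fset).
Proof. by move=> u1 u2 /fset2_inj[[]//|[-> <-]]. Qed.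

Lemma finite_nbr v : finite_set [set u | adj u v].
Proof.
apply: (@sub_finite_set _ _ ((fun u => [fset u; v]%fset) @^-1` edges_at adj v)).
  by move=> u /= uv; split; [exists u, v|rewrite fset22].
apply: finite_preimage; last exact: (graph_locally_finite hG).
by move=> ? ? _ _; exact: edge_inj.
Qed.

Definition nbrs v : {fset V} := fset_set [set u | adj u v].

Lemma mem_nbrs u v : (u \in nbrs v) = adj u v.
Proof. by rewrite in_fset_set; [apply/idP/idP; rewrite inE|exact: finite_nbr]. Qed.

(** It contains both endpoints of every edge that meets [S], so double sums for functions supported
    in [S] can be taken over it. *)
Definition nbhd S : {fset V} := (S `|` \bigcup_(v <- S) nbrs v)%fset.

Lemma nbhd_sub S v : v \in S -> (nbrs v `<=` nbhd S)%fset.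
Proof.
move=> vS; apply/fsubsetP => u uv; rewrite in_fsetU; apply/orP; right.
by apply/bigfcupP; exists v => //; rewrite vS.
Qed.

Lemma sub_nbhd S : (S `<=` nbhd S)%fset.
Proof. exact: fsubsetUl. Qed.

Lemma nbhdS S T : (S `<=` T)%fset -> (nbhd S `<=` nbhd T)%fset.
Proof.
move=> /fsubsetP ST; apply/fsubsetP => u; rewrite in_fsetU => /orP[uS|].
  by rewrite in_fsetU ST.
by move=> /bigfcupP[v /andP[vS _]]; apply/fsubsetP/nbhd_sub/ST.
Qed.

(** The weight vanishes off the neighbours of [v]. Having one [S] common to many vertices is what
    allows sums to be exchanged. *)
Lemma tauE f v S : (nbrs v `<=` S)%fset ->
  tau adj m b f v = ((m v)^-1)%:C * \sum_(u <- S) (b u v)%:C * (f v - f u).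
Proof.
move=> /fsubsetP nS; rewrite /tau; congr (_ * _); apply: fsbig_fwiden => //.
  by move=> u /= uv; apply: nS; rewrite mem_nbrs.
by move=> u [_ /= /negP/weight_nadj ->]; rewrite mul0r.
Qed.

Lemma tauD f g : tau adj m b (f + g) = tau adj m b f + tau adj m b g.
Proof.
apply/funext => v; rewrite [RHS]fun_addE !(tauE _ (fsubset_refl (nbrs v))).
rewrite -mulrDr -big_split/=; congr (_ * _); apply: eq_bigr => u _.
by rewrite !fun_addE; ring.
Qed.

Lemma tauZ z f : tau adj m b (z \*o f) = z \*o tau adj m b f.
Proof.
apply/funext => v; rewrite /= !(tauE _ (fsubset_refl (nbrs v))).
rewrite mulrCA; congr (_ * _); rewrite mulr_sumr; apply: eq_bigr => u _ /=.
by ring.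
Qed.

Lemma tauN f : tau adj m b (- f) = - tau adj m b f.
Proof.
have E g : - g = (-1) \*o g by apply/funext => v; rewrite /= mulN1r.
by rewrite !E tauZ.
Qed.

Lemma tauB f g : tau adj m b (f - g) = tau adj m b f - tau adj m b g.
Proof. by rewrite tauD tauN. Qed.

Definition supported S f := forall v, f v != 0 -> v \in S.

Lemma fin_suppP f : fin_supp f <-> exists S, supported S f.
Proof.
split=> [ff|[S fS]].
  exists (fset_set [set v | f v != 0]) => v fv.
  by rewrite in_fset_set// inE.
by apply: (@sub_finite_set _ _ [set` S]) => // v /=; exact: fS.
Qed.

Lemma supportedS S T f : (S `<=` T)%fset -> supported S f -> supported T f.
Proof. by move=> /fsubsetP ST fS v /fS/ST. Qed.

Lemma supportedP S f v : supported S f -> v \notin S -> f v = 0.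
Proof. by move=> fS vS; apply/eqP; apply: contraNT vS; exact: fS. Qed.

Lemma fin_suppM z f : fin_supp f -> fin_supp (z \*o f).
Proof.
move=> /fin_suppP[S fS]; apply/fin_suppP; exists S => v /= h.
by apply: fS; apply: contraNneq h => ->; rewrite mulr0.
Qed.

Lemma fin_suppD f g : fin_supp f -> fin_supp g -> fin_supp (f + g).
Proof.
move=> /fin_suppP[S fS] /fin_suppP[T gT]; apply/fin_suppP; exists (S `|` T)%fset.
move=> v; rewrite fun_addE in_fsetU => h; apply: contraNT h.
by rewrite negb_or => /andP[/(supportedP fS) -> /(supportedP gT) ->]; rewrite addr0.
Qed.

Lemma fin_suppN f : fin_supp f -> fin_supp (- f).
Proof.
have -> : - f = (-1) \*o f by apply/funext => v; rewrite /= mulN1r.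
exact: fin_suppM.
Qed.

Lemma fin_suppB f g : fin_supp f -> fin_supp g -> fin_supp (f - g).
Proof. by move=> f0 /fin_suppN g0; exact: fin_suppD. Qed.

Lemma supported_tau S f : supported S f -> supported (nbhd S) (tau adj m b f).
Proof.
move=> fS v h; apply: contraNT h => vS.
rewrite (tauE _ (fsubset_refl _)) big_seq big1 ?mulr0// => u uv.
rewrite (supportedP fS) ?(supportedP fS (v := u)) ?subr0 ?mulr0//.
  apply: contra vS => uS; apply: (fsubsetP (nbhd_sub uS)).
  by rewrite mem_nbrs (graph_sym hG) -mem_nbrs.
by apply: contra vS; apply/fsubsetP/sub_nbhd.
Qed.

Lemma fin_supp_tau f : fin_supp f -> fin_supp (tau adj m b f).
Proof.
by move=> /fin_suppP[S fS]; apply/fin_suppP; exists (nbhd S); exact: supported_tau.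
Qed.

Lemma fin_supp_ell2 f : fin_supp f -> ell2 m f.
Proof. exact: ell2_finite. Qed.

Definition qform f g := dot m (tau adj m b f) g.

(** Exchanging the summation variables in the expansion of [qform f g] replaces [g v] by [g u] and
    reverses the difference of [f]; adding both expansions gives the double sum, in which each edge
    occurs in both orientations. Only [g] has finite support, so [f] may later be any function of
    the form domain. *)
Lemma green_formula f g S T : supported T g -> (nbhd T `<=` S)%fset ->
  2 * qform f g =
  \sum_(v <- S) \sum_(u <- S) b u v * cdot (f v - f u) (g v - g u).
Proof.
move=> gT TS.
have E1 : qform f g = \sum_(v <- S) \sum_(u <- S) b u v * cdot (f v - f u) (g v).
  rewrite /qform dotC (@dot_finite _ _ _ _ _ S); last first.
    by apply: supportedS gT; exact: fsubset_trans (sub_nbhd T) TS.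
  apply: eq_bigr => v _; have [vT|vT] := boolP (v \in T); last first.
    rewrite (supportedP gT vT) cdot0l mul0r big1// => u _.
    by rewrite cdotC cdot0l mulr0.
  rewrite cdotC (tauE f (fsubset_trans (nbhd_sub vT) TS)).
  rewrite cdotZl cdot_suml mulrAC mulVf ?mul1r ?gt_eqF//.
  by apply: eq_bigr => u _; rewrite cdotZl.
have E2 : qform f g = \sum_(v <- S) \sum_(u <- S) b u v * cdot (f u - f v) (g u).
  rewrite E1 exchange_big/=; apply: eq_bigr => v _; apply: eq_bigr => u _.
  by rewrite b_sym.
rewrite mulr_natl mulr2n {1}E1 E2 -big_split/=; apply: eq_bigr => v _.
rewrite -big_split/=; apply: eq_bigr => u _.
by case: (f v) (f u) (g v) (g u) => [? ?] [? ?] [? ?] [? ?]; rewrite /cdot /=; ring.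
Qed.

Lemma qform_semi_inner : semi_inner (@rscale R V) (@fin_supp R V) qform.
Proof.
split.
- by move=> a f g f0 g0; apply: fin_suppD => //; exact: fin_suppM.
- by move=> f; apply/funext => v; rewrite /rscale /= mul1r.
- by move=> f; apply/funext => v; rewrite /rscale /= rmorphN mulN1r.
- move=> a f g h f0 g0 h0; rewrite /qform tauD tauZ.
  by rewrite (si_lin (dot_semi_inner m_gt0))//;
    apply: fin_supp_ell2 => //; exact: fin_supp_tau.
- move=> f g /fin_suppP[S fS] /fin_suppP[T gT].
  apply: (@mulfI _ 2) => //.
  rewrite (green_formula _ gT (nbhdS (fsubsetUr S T))).
  rewrite (green_formula _ fS (nbhdS (fsubsetUl S T))).
  by apply: eq_bigr => v _; apply: eq_bigr => u _; rewrite cdotC.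
- move=> f /fin_suppP[S fS]; rewrite -(pmulr_rge0 _ (ltr0n R 2)).
  rewrite (green_formula _ fS (fsubset_refl _)) sumr_ge0// => v _.
  by rewrite sumr_ge0// => u _; rewrite mulr_ge0 ?cdot_ge0.
Qed.

Lemma qformMM z f g : ell2 m (tau adj m b f) -> ell2 m g ->
  qform (z \*o f) (z \*o g) = cdot z z * qform f g.
Proof. by move=> f2 g2; rewrite /qform tauZ dotMM. Qed.

(** The form is controlled by the weighted degrees [c v], which are bounded on a finite set. Their
    sum over [T] serves in place of their maximum. *)
Lemma qform_le_dot T : exists2 K, 0 <= K & forall f, supported T f ->
  qform f f <= K * dot m f f.
Proof.
pose c v := \sum_(u <- nbrs v) b u v / m v.
have c0 v : 0 <= c v by rewrite sumr_ge0// => u _; rewrite mulr_ge0// invr_ge0 ltW.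
exists (2 * \sum_(v <- T) c v).
  by rewrite mulr_ge0// sumr_ge0.
move=> f fT; rewrite -(ler_pM2l (ltr0n R 2)) (green_formula _ fT (fsubset_refl _)).
set S := nbhd T.
apply: (@le_trans _ _ (\sum_(v <- S) \sum_(u <- S)
    b u v * (2 * (cdot (f v) (f v) + cdot (f u) (f u))))).
  by apply: ler_sum => v _; apply: ler_sum => u _; rewrite ler_wpM2l// cdotD_le2.
have -> : \sum_(v <- S) \sum_(u <- S) b u v * (2 * (cdot (f v) (f v) + cdot (f u) (f u)))
    = 4 * \sum_(v <- S) \sum_(u <- S) b u v * cdot (f v) (f v).
  rewrite (_ : 4 = 2 + 2); last by ring.
  rewrite mulrDl !mulr_sumr [X in _ + X](_ : _ =
    2 * \sum_(v <- S) \sum_(u <- S) b u v * cdot (f u) (f u)); last first.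
    rewrite exchange_big/= !mulr_sumr; apply: eq_bigr => v _.
    by congr (_ * _); apply: eq_bigr => u _; rewrite b_sym.
  rewrite mulr_sumr -big_split/=; apply: eq_bigr => v _.
  rewrite !mulr_sumr -big_split/=; apply: eq_bigr => u _; ring.
rewrite [leRHS](_ : _ = 4 * ((\sum_(v <- T) c v) * dot m f f)); last by ring.
rewrite ler_pM2l//.
rewrite (@dot_finite _ _ m f f S (supportedS (sub_nbhd T) fT)) mulr_sumr.
apply: ler_sum => v _; have [vT|vT] := boolP (v \in T); last first.
  rewrite (supportedP fT vT) cdot0l mul0r mulr0.
  by rewrite big1// => u _; rewrite mulr0.
rewrite -mulr_suml -(big_fset_incl _ (nbhd_sub vT)) /=; last first.
  by move=> u _; rewrite mem_nbrs => /weight_nadj.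
rewrite (_ : \sum_(u <- nbrs v) b u v = c v * m v); last first.
  by rewrite /c -mulr_suml divfK// gt_eqF.
rewrite -mulrA (mulrC (m v)) ler_wpM2r//.
  by rewrite mulr_ge0 ?cdot_ge0// ltW.
by rewrite (big_fsetD1 v vT)/= lerDl sumr_ge0.
Qed.

End Graph.

(** * Co-area formula and the Cheeger inequality *)

Lemma fset2C (V : choiceType) (u v : V) : [fset u; v]%fset = [fset v; u]%fset.
Proof. exact: fsetUC. Qed.

Lemma weighted_amgm (R : realFieldType) (t p q : R) : 0 < t ->
  2 * (p * q) <= t^-1 * p ^+ 2 + t * q ^+ 2.
Proof.
move=> t0; have : 0 <= t^-1 * (p - t * q) ^+ 2.
  by rewrite mulr_ge0 ?sqr_ge0// invr_ge0 ltW.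
rewrite [X in 0 <= X](_ : _ = t^-1 * p ^+ 2 + t * q ^+ 2 - 2 * (p * q)) ?subr_ge0//.
by field; rewrite gt_eqF.
Qed.

(** The difference of squares is [cdot (x - y) (x + y)]. The weighted inequality is applied to each
    real coordinate, and the factor in [2 * t] comes from bounding [|x + y|^2] by
    [2 |x|^2 + 2 |y|^2]. *)
Lemma cdot_sqrB_amgm (R : realType) (t l : R) (x y : R[i]) : 0 < t -> 0 <= l ->
  2 * (l * `|cdot x x - cdot y y|) <=
  t^-1 * cdot (x - y) (x - y) + 2 * t * (l ^+ 2 * (cdot x x + cdot y y)).
Proof.
move=> t0 l0.
(* The sign [s] stands for the absolute value and disappears from the right-hand side after
   squaring. *)
have h s : s ^+ 2 = 1 -> 2 * (l * (s * (cdot x x - cdot y y))) <=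
    t^-1 * cdot (x - y) (x - y) + 2 * t * (l ^+ 2 * (cdot x x + cdot y y)).
  case: x y => [x1 x2] [y1 y2] s1; rewrite /cdot /=.
  have h1 := weighted_amgm (x1 - y1) (l * s * (x1 + y1)) t0.
  have h2 := weighted_amgm (x2 - y2) (l * s * (x2 + y2)) t0.
  have k : t * (l * s * (x1 + y1)) ^+ 2 + t * (l * s * (x2 + y2)) ^+ 2 <=
      2 * t * (l ^+ 2 * (x1 * x1 + x2 * x2 + (y1 * y1 + y2 * y2))).
    rewrite !exprMn s1 -subr_ge0.
    rewrite [X in 0 <= X](_ : _ = t * l ^+ 2 * ((x1 - y1) ^+ 2 + (x2 - y2) ^+ 2)).
      by rewrite !mulr_ge0 ?addr_ge0 ?sqr_ge0// ltW.
    by ring.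
  move: (lerD h1 h2) k; lra.
have [w|w] := leP 0 (cdot x x - cdot y y).
  by rewrite ger0_norm//; have := h 1 (expr1n _ _); rewrite mul1r.
by rewrite ltr0_norm//; have := h (-1) (sqrr_sign _ 1); rewrite mulN1r.
Qed.

Section Cheeger.
Variables (R : realType) (V : choiceType) (adj : rel V).
Variables (m : V -> R) (b : V -> V -> R) (d : {fset V} -> R).
Hypotheses (hG : is_graph adj) (hw : is_weight adj m b).
Hypotheses (hd : forall e, edges adj e -> 0 < d e) (hint : intrinsic adj m b d).
Implicit Types (f g h : V -> R[i]) (a : R) (z : R[i]) (S T : {fset V}) (u v : V).

Let m_gt0 := weight_vertex_gt0 hw.
Let b_ge0 := weight_ge0 hw.
Let b_sym := weight_sym hw.

Lemma edge_weightE u v : edge_weight b [fset u; v]%fset = b u v.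
Proof.
rewrite /edge_weight; case: xgetP => [r -> [u' [v' [/fset2_inj[[-> ->]|[-> ->]] ->]]]//|].
by move=> /(_ (b u v)); case; exists u, v.
Qed.

Definition edge_length u v : R := d [fset u; v]%fset.

Lemma edge_length_sym u v : edge_length u v = edge_length v u.
Proof. by rewrite /edge_length fset2C. Qed.

Lemma edge_length_weight_ge0 u v : 0 <= edge_length u v * b u v.
Proof.
have [uv|uv] := boolP (adj u v); last by rewrite (weight_nadj hw uv) mulr0.
by rewrite mulr_ge0// ltW// hd//; exists u, v.
Qed.

(** An edge at [v] is determined by its other endpoint, so the intrinsic condition becomes a bound
    on row sums. *)
Lemma intrinsic_sum v S : (nbrs adj v `<=` S)%fset ->
  \sum_(u <- S) edge_length v u ^+ 2 * b v u <= m v.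
Proof.
move=> /fsubsetP nS; apply: le_trans (hint v).
rewrite (@reindex_fsbig _ _ _ _ _ (fun u => [fset v; u]%fset) [set u | adj u v]); last first.
  split.
  - move=> u /= uv; split; last by rewrite fset21.
    by exists v, u; rewrite (graph_sym hG).
  - by move=> u1 u2 _ _; rewrite ![[fset v; _]%fset]fset2C => /edge_inj.
  - move=> e [[u1 [u2 [u12 ->]]]]; rewrite in_fset2 => /orP[/eqP ->|/eqP ->].
      by exists u2 => //=; rewrite (graph_sym hG).
    by exists u1 => //=; rewrite fset2C.
rewrite [leRHS](@fsbig_fwiden _ _ _ _ S)//.
- by under [leRHS]eq_bigr do rewrite edge_weightE.
- by move=> u /= uv; apply: nS; rewrite mem_nbrs.
- move=> u [_ /= /negP uv]; rewrite edge_weightE.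
  by rewrite b_sym (weight_nadj hw uv) mulr0.
Qed.

(** Each boundary edge has exactly one orientation leading out of [T], which turns a sum over
    unordered edges into one over ordered pairs; non-adjacent pairs contribute zero. *)
Lemma boundary_sum T S : (nbhd adj T `<=` S)%fset ->
  \sum_(e \in edge_boundary adj [set` T]) (d e * edge_weight b e) =
  \sum_(v <- S) \sum_(u <- S)
    if (v \in T) && (u \notin T) then edge_length v u * b v u else 0.
Proof.
move=> TS.
pose P := [set p : V * V | [/\ p.1 \in T, p.2 \notin T & adj p.1 p.2]].
rewrite (@reindex_fsbig _ _ _ _ _ (fun p => [fset p.1; p.2]%fset) P); last first.
  split.
  - by move=> [u v] /= [uT vT uv]; exists u, v; split=> //; exact/negP.
  - move=> [u v] [u' v'] /set_mem[/= uT vT _] /set_mem[/= uT' vT' _].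
    by move=> /fset2_inj[[-> ->]//|[uv' _]]; move: vT'; rewrite -uv' uT.
  - by move=> e [u [v [uT /negP vT uv ->]]]; exists (u, v).
rewrite (eq_fsbigr (fun p => if (p.1 \in T) && (p.2 \notin T)
    then edge_length p.1 p.2 * b p.1 p.2 else 0)); last first.
  by move=> [u v]; rewrite inE => -[/= -> -> _]; rewrite edge_weightE.
rewrite (fsbig_widen _ ([set` S] `*` [set` S])); last 2 first.
- move=> [u v] [/= uT vT uv]; split=> /=.
    exact/(fsubsetP TS)/(fsubsetP (sub_nbhd adj T)).
  by apply/(fsubsetP TS)/(fsubsetP (nbhd_sub adj uT)); rewrite mem_nbrs// (graph_sym hG).
- move=> [u v] [_ /= nP]; case: ifP => // /andP[uT vT].
  by rewrite (weight_nadj hw) ?mulr0//; apply/negP => uv; apply: nP.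
rewrite -(@pair_fsbig _ _ _ _ _ [set` S] [set` S] (fun v u => if (v \in T) && (u \notin T)
    then edge_length v u * b v u else 0))//=.
rewrite fsbig_finite//= set_fsetK; apply: eq_bigr => v _.
by rewrite fsbig_finite//= set_fsetK.
Qed.

Variables (a : R) (U : set V).
Hypotheses (a_ge0 : 0 <= a) (aU : (a%:E <= isoperimetric adj m b d U)%E).

(** The co-area inequality for an indicator function. The absolute value is 1 exactly on pairs
    separated by [T], and each boundary edge is met in both orientations, hence the factor 2. *)
Lemma isoperimetric_le S T : [set` T] `<=` U -> (nbhd adj T `<=` S)%fset ->
  2 * a * \sum_(v <- T) m v <= \sum_(v <- S) \sum_(u <- S)
    edge_length v u * b v u * `|(v \in T)%:R - (u \in T)%:R|.
Proof.
move=> TU TS; have [->|/fset0Pn[v0 v0T]] := eqVneq T fset0.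
  rewrite big_seq_fset0 mulr0 sumr_ge0// => v _; rewrite sumr_ge0// => u _.
  by rewrite mulr_ge0// edge_length_weight_ge0.
pose F v u := if (v \in T) && (u \notin T) then edge_length v u * b v u else 0.
have -> : \sum_(v <- S) \sum_(u <- S)
      edge_length v u * b v u * `|(v \in T)%:R - (u \in T)%:R| =
    2 * \sum_(v <- S) \sum_(u <- S) F v u.
  rewrite mulr_natl mulr2n [X in _ = _ + X]exchange_big/= -big_split/=.
  apply: eq_bigr => v _; rewrite -big_split/=; apply: eq_bigr => u _.
  rewrite /F (edge_length_sym u) (b_sym u).
  by case: (v \in T) (u \in T) => [] [] /=;
    rewrite ?subrr ?subr0 ?sub0r ?normrN ?normr0 ?normr1; ring.
rewrite -mulrA ler_pM2l// -boundary_sum//.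
have mT : 0 < \sum_(v <- T) m v.
  by rewrite (big_fsetD1 v0 v0T)/= ltr_pwDl// sumr_ge0// => v _; rewrite ltW.
rewrite -ler_pdivlMr// -lee_fin; apply: le_trans aU _.
apply: ereal_inf_lbound; exists [set` T].
  by split=> //; exists v0.
by rewrite [in X in _ / X]fsbig_finite//= set_fsetK.
Qed.

(* Layer-cake induction: subtracting the smallest value of [p] on its support
   [T] strictly shrinks the support and splits off a multiple of the indicator
   of [T], to which the isoperimetric inequality applies. *)
Lemma coarea S T (p : V -> R) : [set` T] `<=` U -> (nbhd adj T `<=` S)%fset ->
  (forall v, 0 <= p v) -> (forall v, v \notin T -> p v = 0) ->
  2 * a * \sum_(v <- T) p v * m v <=
  \sum_(v <- S) \sum_(u <- S) edge_length v u * b v u * `|p v - p u|.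
Proof.
have [n] := ubnP #|` T|; elim: n => // n IH in T p * => cT TU TS p0 pT.
have [T0|/fset0Pn[v0 v0T]] := eqVneq T fset0.
  rewrite T0 big_seq_fset0 mulr0 sumr_ge0// => v _; rewrite sumr_ge0// => u _.
  by rewrite mulr_ge0// edge_length_weight_ge0.
have [v1 v1T p1] : exists2 v1, v1 \in T & forall v, v \in T -> p v1 <= p v.
  have [[v1 v1T] _ h] := arg_minP (P := xpredT) (fun v : T => p (val v))
    (i0 := [` v0T]%fset) isT.
  by exists v1 => // v vT; exact: h [` vT]%fset isT.
pose c := p v1; pose p' v := if v \in T then p v - c else 0.
pose T' := [fset v in T | v != v1]%fset.
have T'T : (T' `<=` T)%fset by exact: fset_sub.
have : 2 * a * \sum_(v <- T') p' v * m v <=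
    \sum_(v <- S) \sum_(u <- S) edge_length v u * b v u * `|p' v - p' u|.
  apply: IH.
  - apply: leq_trans (_ : #|` T| <= n)%N => //; apply: fproper_ltn_card.
    rewrite fproperEneq T'T andbT; apply/eqP => /fsetP/(_ v1).
    by rewrite !inE /= eqxx v1T.
  - by move=> v /= /(fsubsetP T'T); exact: TU.
  - exact: fsubset_trans (nbhdS adj T'T) TS.
  - by move=> v; rewrite /p'; case: ifPn => // vT; rewrite subr_ge0 p1.
  - move=> v; rewrite !inE /= /p'; case: ifP => //= vT; rewrite negbK => /eqP ->.
    by rewrite subrr.
have := isoperimetric_le TU TS => /(ler_wpM2l (p0 v1)) hT hT'.
have -> : 2 * a * \sum_(v <- T) p v * m v =
    2 * a * \sum_(v <- T') p' v * m v + c * (2 * a * \sum_(v <- T) m v).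
  rewrite (big_fset_incl _ T'T)/=; last first.
    move=> v vT; rewrite !inE/= vT/= negbK /p' vT => /eqP ->.
    by rewrite subrr mul0r.
  rewrite (_ : \sum_(v <- T) p v * m v =
      \sum_(v <- T) p' v * m v + c * \sum_(v <- T) m v); first by ring.
  rewrite mulr_sumr -big_split/=.
  by apply: eq_big_seq => v vT; rewrite /p' vT; ring.
(* Two vertices of [T] keep their difference when [c] is subtracted; across the boundary of [T]
   exactly [c] is lost, and the indicator term restores it. *)
apply: le_trans (lerD hT' hT) _.
rewrite mulr_sumr -big_split/=; apply: ler_sum => v _.
rewrite mulr_sumr -big_split/=; apply: ler_sum => u _.
rewrite mulrCA -mulrDr ler_wpM2l ?edge_length_weight_ge0// /p'.
have c0 : 0 <= c := p0 v1.
have [vT|vT] := boolP (v \in T); have [uT|uT] := boolP (u \in T).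
- by rewrite subrr normr0 mulr0 addr0 opprB addrA subrK.
- rewrite (pT u)// !subr0 normr1 mulr1 ger0_norm ?subr_ge0 ?p1//.
  by rewrite subrK ler_norm.
- rewrite (pT v)// !sub0r !normrN normr1 mulr1 ger0_norm ?subr_ge0 ?p1//.
  by rewrite subrK ler_norm.
- by rewrite subrr normr0 mulr0 addr0 !pT ?subrr.
Qed.

Lemma cheeger f T : supported T f -> [set` T] `<=` U ->
  2^-1 * a ^+ 2 * dot m f f <= qform adj m b f f.
Proof.
move=> fT TU; set S := nbhd adj T.
have q0 : 0 <= qform adj m b f f.
  by apply: (si_ge0 (qform_semi_inner hG hw)); apply/fin_suppP; exists T.
have [->|a0] := eqVneq a 0; first by rewrite expr0n/= mulr0 mul0r.
have ap : 0 < a by rewrite lt_def a0.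
(* After multiplication by [t], the estimate below reads [(4 * a * t - 4 * t ^+ 2) * dot m f f <= 2
   * q]; this [t] maximizes the coefficient, with value [a ^+ 2], which is the origin of the
   constant 1/2. *)
pose t := a / 2; have tp : 0 < t by rewrite divr_gt0.
have cS : 2 * a * dot m f f <=
    \sum_(v <- S) \sum_(u <- S) edge_length v u * b v u *
      `|cdot (f v) (f v) - cdot (f u) (f u)|.
  rewrite (@dot_finite _ _ m f f T)//; apply: coarea => //.
    by move=> v; exact: cdot_ge0.
  by move=> v vT; rewrite (supportedP fT vT) cdot0l.
have {cS} cS : 2 * (2 * a * dot m f f) <=
    t^-1 * (2 * qform adj m b f f) + 4 * t * dot m f f.
  apply: (@le_trans _ _ (\sum_(v <- S) \sum_(u <- S)
      (t^-1 * (b v u * cdot (f v - f u) (f v - f u)) +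
       2 * t * (edge_length v u ^+ 2 * b v u * (cdot (f v) (f v) + cdot (f u) (f u)))))).
    apply: le_trans (ler_wpM2l _ cS) _ => //.
    rewrite mulr_sumr; apply: ler_sum => v _; rewrite mulr_sumr; apply: ler_sum => u _.
    have [vu|vu] := boolP (adj v u); last first.
      by rewrite (weight_nadj hw vu) !(mulr0, mul0r) addr0.
    have l0 : 0 <= edge_length v u by rewrite ltW// hd//; exists v, u.
    have := ler_wpM2l (b_ge0 v u) (cdot_sqrB_amgm (f v) (f u) tp l0).
    by lra.
  under eq_bigr do rewrite big_split/= -!mulr_sumr.
  rewrite big_split/= -!mulr_sumr lerD//.
    rewrite ler_pM2l ?invr_gt0// (green_formula hG hw f fT (fsubset_refl _)).
    apply: ler_sum => v _; apply: ler_sum => u _.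
    by rewrite (b_sym v).
  rewrite (_ : 4 * t * dot m f f = 2 * t * (2 * dot m f f)); last by ring.
  rewrite ler_pM2l ?mulr_gt0//.
  have -> : \sum_(v <- S) \sum_(u <- S)
      edge_length v u ^+ 2 * b v u * (cdot (f v) (f v) + cdot (f u) (f u)) =
    2 * \sum_(v <- S) \sum_(u <- S) edge_length v u ^+ 2 * b v u * cdot (f v) (f v).
    rewrite [RHS]mulr_natl mulr2n [X in _ = _ + X]exchange_big/= -big_split/=.
    apply: eq_bigr => v _; rewrite -big_split/=; apply: eq_bigr => u _.
    by rewrite (edge_length_sym u) (b_sym u) mulrDr.
  rewrite ler_pM2l// (@dot_finite _ _ m f f S (supportedS (sub_nbhd adj T) fT)).
  (* For [v] in [T], all neighbours lie in [S] and intrinsicness bounds the row by [m v]; elsewhere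
     [f v] is zero. *)
  apply: ler_sum => v _; have [vT|vT] := boolP (v \in T); last first.
    by rewrite (supportedP fT vT) cdot0l mul0r big1// => u _; rewrite mulr0.
  rewrite -mulr_suml mulrC ler_wpM2l ?cdot_ge0//.
  by apply: intrinsic_sum; exact: nbhd_sub.
have := ler_wpM2l (ltW tp) cS.
rewrite [leRHS](_ : _ = 2 * qform adj m b f f + 4 * t ^+ 2 * dot m f f).
  by rewrite /t expr2 expr2; lra.
by field; rewrite gt_eqF.
Qed.

End Cheeger.

(** * Friedrichs extension *)

Section ComplexLimits.
Variable R : realType.

Lemma cvg_Re (x : nat -> R[i]) (y : R[i]) : (x : nat -> R[i]^o) @ \oo --> (y : R[i]^o) ->
  (fun n => complex.Re (x n)) @ \oo --> complex.Re y.
Proof.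
move=> /cvgrPdist_lt h; apply/cvgn_epsP => e e0.
have [|N _ hN] := h e%:C; first by rewrite ltcR.
exists N => n Nn; have := hN n Nn; rewrite /= distrC.
rewrite -ReB; move: (_ - _) => z; rewrite normc_def ltcR; apply: le_lt_trans.
by rewrite -sqrtr_sqr ler_wsqrtr// lerDl sqr_ge0.
Qed.

Lemma cvg_complex (x : nat -> R[i]) (y : R[i]) :
  (fun n => complex.Re (x n)) @ \oo --> complex.Re y ->
  (fun n => complex.Im (x n)) @ \oo --> complex.Im y ->
  (x : nat -> R[i]^o) @ \oo --> (y : R[i]^o).
Proof.
move=> /cvgn_epsP h1 /cvgn_epsP h2; apply/cvgrPdist_lt => -[e ei].
rewrite ltcE/= => /andP[/eqP ei0 e0]; rewrite {}ei0.
have [|N1 hN1] := h1 (e / 2); first by rewrite divr_gt0.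
have [|N2 hN2] := h2 (e / 2); first by rewrite divr_gt0.
exists (maxn N1 N2) => // n /=; rewrite geq_max => /andP[/hN1 k1 /hN2 k2].
rewrite distrC; move: k1 k2; rewrite -ReB -ImB; move: (_ - _) => z k1 k2.
rewrite normc_def ltcR -(ltr_pXn2r (n := 2)) ?nnegrE ?sqrtr_ge0 ?(ltW e0)//.
rewrite sqr_sqrtr ?addr_ge0 ?sqr_ge0//.
rewrite -[X in X + _]real_normK ?num_real// -[X in _ + X]real_normK ?num_real//.
have := normr_ge0 (complex.Re z); have := normr_ge0 (complex.Im z).
by move: k1 k2; set p := `|_|; set q := `|_|; nra.
Qed.

End ComplexLimits.

(** * Lower bound for the form with a potential on a finite set *)

Section Perturbation.
Variables (R : realType) (V : choiceType) (adj : rel V).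
Variables (m : V -> R) (b : V -> V -> R) (d : {fset V} -> R).
Hypotheses (hG : is_graph adj) (hw : is_weight adj m b).
Hypotheses (hd : forall e, edges adj e -> 0 < d e) (hint : intrinsic adj m b d).

Let m_gt0 := weight_vertex_gt0 hw.

Definition restr (X : {fset V}) (f : V -> R[i]) v := if v \in X then f v else 0.

Lemma supported_restr (X : {fset V}) f : supported X (restr X f).
Proof. by move=> v; rewrite /restr; case: ifP => //; rewrite eqxx. Qed.

(** Split off the restriction of [f] to [X]. The rest lives outside [X], where the Cheeger bound
    holds with a constant [L] larger than [l]. Passing from its energy to that of [f] costs a factor
    [1 + e] and a multiple of the energy of the restriction, which is bounded by the mass on [X].
    The gap between [l] and [L] pays for the factor, and the potential pays for the mass. *)
Lemma perturbed_bound (X : {fset V}) (a l : R) : 0 <= a ->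
  (a%:E <= isoperimetric adj m b d (~` [set` X]))%E -> l < 2^-1 * a ^+ 2 ->
  exists2 c, 0 <= c & forall f, fin_supp f ->
    l * dot m f f <= qform adj m b f f + c * \sum_(v <- X) cdot (f v) (f v) * m v.
Proof.
move=> a0 aX la; have qsi := qform_semi_inner hG hw.
have N0 f : 0 <= \sum_(v <- X) cdot (f v) (f v) * m v.
  by rewrite sumr_ge0// => v _; rewrite cdotm_ge0.
have [l0|l0] := leP l 0.
  exists 0 => // f f0; rewrite mul0r addr0; apply: le_trans (si_ge0 qsi f0).
  by rewrite mulr_le0_ge0// dot_ge0//; exact: fin_supp_ell2.
(* Here [1 + e = L / l], so division by [1 + e] turns [L] into [l]. *)
set L := 2^-1 * a ^+ 2 in la; pose e := L / l - 1.
have e0 : 0 < e by rewrite subr_gt0 ltr_pdivlMr// mul1r.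
have [K K0 hK] := qform_le_dot hG hw X.
(* The summand [l] covers the mass of [f] on [X], and [K / e] is [(1 + e^-1) * K] divided by
   [1 + e]. *)
exists (l + K / e); first by rewrite addr_ge0 ?divr_ge0// ltW.
move=> f /[dup] f0 /fin_suppP[T fT].
have r0 : fin_supp (restr X f) by apply/fin_suppP; exists X; exact: supported_restr.
have g0 : fin_supp (f - restr X f) by exact: fin_suppB.
have N1 : dot m (restr X f) (restr X f) = \sum_(v <- X) cdot (f v) (f v) * m v.
  rewrite (@dot_finite _ _ m _ _ X (@supported_restr X f)).
  by apply: eq_big_seq => v vX; rewrite /restr vX.
have N2 : dot m f f = dot m (restr X f) (restr X f) +
    dot m (f - restr X f) (f - restr X f).
  pose S := (T `|` X)%fset.
  have rS : supported S (restr X f).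
    by apply: supportedS (@supported_restr X f); exact: fsubsetUr.
  have fS : supported S f by apply: supportedS fT; exact: fsubsetUl.
  have gS : supported S (f - restr X f).
    move=> v h; apply: contraNT h => vS; rewrite fun_addE.
    by rewrite (supportedP fS vS) add0r oppr_eq0; apply/eqP/(supportedP rS vS).
  rewrite (@dot_finite _ _ m f f S fS) (@dot_finite _ _ m _ _ S rS).
  rewrite (@dot_finite _ _ m _ _ S gS) -big_split/=; apply: eq_bigr => v _.
  rewrite fun_addE /restr [(- _) v](_ : _ = - (if v \in X then f v else 0))//.
  by case: ifP => _; rewrite ?subrr ?subr0 ?cdot0l; ring.
have h1 : L * dot m (f - restr X f) (f - restr X f) <=
    qform adj m b (f - restr X f) (f - restr X f).
  apply: (cheeger hG hw hd hint a0 aX (T := [fset v in T | v \notin X]%fset)).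
    move=> v h; rewrite !inE/=; apply: contraNT h; rewrite fun_addE.
    rewrite [(- _) v](_ : _ = - restr X f v)// /restr.
    have [_|/(supportedP fT) ->] := boolP (v \in T); last by case: ifP; rewrite ?subr0.
    by rewrite negbK => ->; rewrite subrr.
  by move=> v /=; rewrite !inE/= => /andP[_ /negP].
have h2 := si_sqrB_le qsi e0 f0 r0.
have h3 := hK _ (@supported_restr X f).
rewrite mulrDl -N1 N2.
have : l / L * (L * dot m (f - restr X f) (f - restr X f)) <=
   l / L * ((1 + e) * qform adj m b f f + (1 + e^-1) * (K * dot m (restr X f) (restr X f))).
  rewrite ler_wpM2l ?divr_ge0 ?(ltW l0)//; first by rewrite ltW// (lt_trans l0).
  apply: le_trans h1 (le_trans h2 _); rewrite lerD2l ler_wpM2l//.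
  by rewrite addr_ge0 ?invr_ge0// ltW.
have L0 : L != 0 by rewrite gt_eqF// (lt_trans l0).
rewrite mulrA divfK//.
set n1 := dot m (restr X f) _; set n2 := dot m (f - _) _; set q := qform _ _ _ _ _.
rewrite [leRHS](_ : _ = q + K / e * n1); first by lra.
have -> : l / L = (1 + e)^-1 by rewrite /e addrC subrK invf_div.
field; rewrite gt_eqF//= gt_eqF// addr_gt0//.
Qed.

End Perturbation.

(** * Form domain and operator domain *)

Section Friedrichs.
Variables (R : realType) (V : choiceType) (adj : rel V).
Variables (m : V -> R) (b : V -> V -> R).
Hypotheses (hG : is_graph adj) (hw : is_weight adj m b).
Implicit Types (F G : nat -> V -> R[i]) (f g h w : V -> R[i]) (z : R[i]).

Let m_gt0 := weight_vertex_gt0 hw.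
Let dsi := dot_semi_inner m_gt0.
Let qsi := qform_semi_inner hG hw.

Local Notation tau := (tau adj m b).
Local Notation q := (qform adj m b).

Definition energy f : R := Num.sqrt (q f f).

Lemma energy_ge0 f : 0 <= energy f. Proof. exact: sqrtr_ge0. Qed.

Lemma energy_sqr f : fin_supp f -> energy f ^+ 2 = q f f.
Proof. by move=> f0; rewrite sqr_sqrtr// (si_ge0 qsi). Qed.

Lemma fs_ell2 f : fin_supp f -> ell2 m f.
Proof. exact: fin_supp_ell2. Qed.
Hint Resolve fs_ell2 : core.

Lemma qform_le f g : fin_supp f -> fin_supp g -> `|q f g| <= energy f * energy g.
Proof. exact: (si_abs_le qsi). Qed.

Lemma dot0r g : dot m g 0 = 0.
Proof.
rewrite dotC (@dot_finite _ _ m _ _ fset0) ?big_seq_fset0// => v.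
by rewrite eqxx.
Qed.

Definition restr1 v f : V -> R[i] := restr [fset v]%fset f.

Lemma fin_supp_restr X f : fin_supp (@restr R V X f).
Proof. by apply/fin_suppP; exists X; exact: supported_restr. Qed.

Lemma dot_restr1 f g v : dot m f (restr1 v g) = cdot (f v) (g v) * m v.
Proof.
rewrite dotC (@dot_finite _ _ m _ _ _ (@supported_restr R V [fset v]%fset g)).
by rewrite big_seq_fset1 /restr inE eqxx cdotC.
Qed.

(* Only finitely many values of [f] enter either side, so [f] may be truncated. *)
Lemma qform_dot_tau f h : fin_supp h -> q f h = dot m f (tau h).
Proof.
move=> /[dup] h0 /fin_suppP[T hT]; set S := nbhd adj T.
have hS : supported S (tau h) by exact: supported_tau.
have E : dot m (tau h) f = dot m (tau h) (restr S f).
  rewrite !(@dot_finite _ _ m _ _ S hS); apply: eq_big_seq => v vS.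
  by rewrite /restr vS.
rewrite dotC E; have r0 := fin_supp_restr S f.
rewrite -[RHS]/(q h (restr S f)) (si_sym qsi h0 r0).
apply: (@mulfI _ 2) => //; rewrite !(green_formula hG hw _ hT (fsubset_refl _)).
apply: eq_big_seq => v vS; apply: eq_big_seq => u uS.
by rewrite /restr vS uS.
Qed.

(** Form convergence, restated with norms instead of their squares so that triangle inequalities
    apply directly. *)
Record approx F f : Prop := Approx {
  approx_supp : forall n, fin_supp (F n);
  approx_ell2 : ell2 m f;
  approx_cvg : (fun n => nrm m (F n - f)) @ \oo --> (0 : R);
  approx_cauchy : forall e, 0 < e -> exists N, forall i j,
    (N <= i)%N -> (N <= j)%N -> energy (F i - F j) < e }.

Lemma approxP F f : ell2 m f -> form_cvg m (@fin_supp R V) tau F f <-> approx F f.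
Proof.
move=> f2.
have C F0 : (forall n, fin_supp (F n)) ->
   ((fun n => sqnorm m (F n \- f)) @ \oo --> 0%E <->
   (fun n => nrm m (F n - f)) @ \oo --> (0 : R)).
  by move=> F0'; apply: (sqnorm_cvg0 m_gt0) => n; apply: ell2B => //; exact: fs_ell2.
split=> [[F0 Fc Fq]|[F0 _ Fc Fq]]; split=> //; try exact/C.
- move=> e e0; have [|N hN] := Fq (e ^+ 2); first by rewrite exprn_gt0.
  exists N => i j Ni Nj; have := hN i j Ni Nj; rewrite inner_dot/= => h.
  rewrite -(ltr_pXn2r (n := 2)) ?nnegrE ?energy_ge0 ?(ltW e0)//.
  by rewrite energy_sqr//; exact: fin_suppB.
- move=> e e0; have [|N hN] := Fq (Num.sqrt e); first by rewrite sqrtr_gt0.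
  exists N => i j Ni Nj; have := hN i j Ni Nj; rewrite inner_dot/= => h.
  rewrite -[X in _ < X]sqr_sqrtr ?(ltW e0)// -[X in X < _](@energy_sqr (F i - F j)).
    by rewrite ltr_pXn2r ?nnegrE ?energy_ge0 ?sqrtr_ge0.
  exact: fin_suppB.
Qed.

Lemma approx_const f : fin_supp f -> approx (fun=> f) f.
Proof.
move=> f0; split=> //; first exact: fs_ell2.
  by rewrite subrr nrm0; exact: cvg_cst.
move=> e e0; exists 0%N => i j _ _.
by rewrite subrr /energy /qform dot0r sqrtr0.
Qed.

Lemma energyM z f : fin_supp f -> energy (z \*o f) = Normc.normc z * energy f.
Proof.
move=> f0; rewrite /energy qformMM//; last 2 first.
  by apply: fs_ell2; exact: fin_supp_tau.
  exact: fs_ell2.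
rewrite -normc_sqr sqrtrM ?sqr_ge0// sqrtr_sqr ger0_norm//.
by case: z => ? ? /=; rewrite sqrtr_ge0.
Qed.

Lemma approxM z F f : approx F f -> approx (fun n => z \*o F n) (z \*o f).
Proof.
case=> F0 f2 Fc Fq.
have E g h : z \*o g - z \*o h = z \*o (g - h).
  by apply/funext => v; rewrite fun_addE /= mulrBr.
split=> [n|||].
- exact: fin_suppM.
- exact: ell2M.
- apply: (@cvg_ext _ _ (fun n => Normc.normc z * nrm m (F n - f))).
    by move=> n; rewrite E nrmM//; apply: ell2B => //; exact: fs_ell2.
  by apply: (@cvg_bounded0 _ _ _ `|Normc.normc z|).
- move=> e e0; have z0 : 0 < Normc.normc z + 1.
    by rewrite ltr_wpDl//; case: z {E} => ? ? /=; rewrite sqrtr_ge0.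
  have [|N hN] := Fq (e / (Normc.normc z + 1)); first by rewrite divr_gt0.
  exists N => i j Ni Nj; rewrite E energyM; last exact: fin_suppB.
  have := hN i j Ni Nj; rewrite ltr_pdivlMr// mulrDr mulr1 mulrC.
  by apply: le_lt_trans; rewrite lerDl energy_ge0.
Qed.

Lemma approxD F f G g : approx F f -> approx G g -> approx (fun n => F n + G n) (f + g).
Proof.
case=> F0 f2 Fc Fq [G0 g2 Gc Gq].
have E (x y x' y' : V -> R[i]) : (x + y) - (x' + y') = (x - x') + (y - y').
  by rewrite opprD addrACA.
split=> [n|||].
- exact: fin_suppD.
- exact: ell2D.
- apply: (@cvg_le_cvg0 _ _ (fun n => nrm m (F n - f) + nrm m (G n - g))).
    move=> n; rewrite ger0_norm ?nrm_ge0// E nrmD//; apply: ell2B => //; exact: fs_ell2.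
  have : (fun n => nrm m (F n - f) + nrm m (G n - g)) @ \oo --> (0 : R) + 0 by exact: cvgD.
  by rewrite addr0.
- move=> e e0.
  have [|N hN] := Fq (e / 2); first by rewrite divr_gt0.
  have [|M hM] := Gq (e / 2); first by rewrite divr_gt0.
  exists (maxn N M) => i j; rewrite !geq_max => /andP[Ni Mi] /andP[Nj Mj].
  rewrite E; apply: le_lt_trans (si_sqrt_D qsi _ _) _; try exact: fin_suppB.
  by have := hN i j Ni Nj; have := hM i j Mi Mj; rewrite /energy; lra.
Qed.

Lemma approxB F f G g : approx F f -> approx G g -> approx (fun n => F n - G n) (f - g).
Proof.
move=> hF hG'; have E (x : V -> R[i]) : - x = (-1) \*o x.
  by apply/funext => v; rewrite /= mulN1r.
rewrite E (_ : (fun n => _) = (fun n => F n + (-1) \*o G n)).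
  by apply: approxD => //; exact: approxM.
by apply/funext => n; rewrite E.
Qed.

Lemma approx_bounded F f : approx F f ->
  exists N c, 0 <= c /\ forall n, (N <= n)%N -> energy (F n) <= c.
Proof.
case=> F0 _ _ Fq; have [N hN] := Fq 1 ltr01.
exists N, (1 + energy (F N)); split; first by rewrite addr_ge0// energy_ge0.
move=> n Nn; rewrite -[F n](subrK (F N)).
apply: le_trans (si_sqrt_D qsi _ _) _ => //; first exact: fin_suppB.
by rewrite lerD2r ltW// hN.
Qed.

Lemma approx_cvg_ell2 F f g : approx F f -> ell2 m g ->
  (fun n => dot m g (F n)) @ \oo --> dot m g f.
Proof.
case=> F0 f2 Fc _ g2; apply/cvg_sub0.
apply: (@cvg_le_cvg0 _ _ (fun n => nrm m g * nrm m (F n - f))).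
  move=> n; rewrite -dotBr//; last exact: fs_ell2.
  by apply: dot_le => //; apply: ell2B => //; exact: fs_ell2.
by apply: (@cvg_bounded0 _ _ _ `|nrm m g|).
Qed.

Lemma approx_cvg_qform F f h : approx F f -> fin_supp h ->
  (fun n => q (F n) h) @ \oo --> q f h.
Proof.
move=> hF h0; rewrite qform_dot_tau// dotC.
apply: (@cvg_ext _ _ (fun n => dot m (tau h) (F n))).
  by move=> n; rewrite qform_dot_tau// dotC.
by apply: approx_cvg_ell2 hF _; apply: fs_ell2; exact: fin_supp_tau.
Qed.

(** Closability. In [q (F n) (F n) = q (F n) (F n - F k) + q (F n) (F k)] the first term is small by
    the Cauchy property, and the second is the pairing of [F k] with the fixed square-summable
    function [tau (F n)], so it tends to zero with [k]. *)
Lemma energy_closable F : approx F 0 -> (fun n => energy (F n)) @ \oo --> (0 : R).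
Proof.
move=> hF; have [N [c [c0 hc]]] := approx_bounded hF.
have [F0 _ _ Fq] := hF.
apply/cvgn_epsP => e e0.
have [|M hM] := Fq (e ^+ 2 / (c + 1)).
  by rewrite divr_gt0 ?exprn_gt0// ltr_wpDl.
exists (maxn N M) => n; rewrite geq_max => /andP[Nn Mn].
rewrite subr0 ger0_norm ?energy_ge0//.
rewrite -(ltr_pXn2r (n := 2)) ?nnegrE ?energy_ge0 ?(ltW e0)//.
rewrite energy_sqr//.
have lim : (fun k => q (F n) (F k)) @ \oo --> (0 : R).
  have := approx_cvg_ell2 hF (fs_ell2 (fin_supp_tau hG hw (F0 n))).
  by rewrite dot0r.
have step : q (F n) (F n) - c * (e ^+ 2 / (c + 1)) <= 0.
  apply: (cvg_ge (N := M) lim) => k Mk.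
  rewrite lerBlDr -lerBlDl -(si_Br qsi)//.
  apply: le_trans (ler_norm _) _; apply: le_trans (qform_le _ _) _ => //.
    exact: fin_suppB.
  by apply: ler_pM; [exact: energy_ge0|exact: energy_ge0|exact: hc|exact/ltW/hM].
apply: le_lt_trans (_ : c * (e ^+ 2 / (c + 1)) < _); first by rewrite -subr_le0.
by rewrite mulrA ltr_pdivrMr ?ltr_wpDl// mulrC ltr_pM2l ?exprn_gt0// ltrDl.
Qed.

(** Replacing [G n] by [g] costs [q (F n) (G n - g)], which vanishes in the limit by closability,
    since [G n - g] approximates zero. *)
Lemma approx_cvg_qform2 F f G g : approx F f -> approx G g -> fin_supp g ->
  (fun n => q (F n) (G n)) @ \oo --> q f g.
Proof.
move=> hF hGg g0; have [N [c [c0 hc]]] := approx_bounded hF.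
have [F0 _ _ _] := hF; have [G0 _ _ _] := hGg.
have : approx (fun n => G n - g) 0.
  by rewrite -(subrr g); apply: approxB => //; exact: approx_const.
move=> /energy_closable /cvgn_epsP e0.
have /cvgn_epsP l := approx_cvg_qform hF g0.
apply/cvgn_epsP => e ep.
have [|M1 h1] := l (e / 2); first by rewrite divr_gt0.
have cp : 0 < 2 * (c + 1) by rewrite mulr_gt0// ltr_wpDl.
have [|M2 h2] := e0 (e / (2 * (c + 1))); first by rewrite divr_gt0.
exists (maxn N (maxn M1 M2)) => n; rewrite !geq_max => /and3P[Nn M1n M2n].
have k1 := h1 n M1n; have := h2 n M2n.
rewrite subr0 ger0_norm ?energy_ge0// => k2.
have Gg0 : fin_supp (G n - g) by exact: fin_suppB.
have k3 : `|q (F n) (G n - g)| <= c * energy (G n - g).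
  by apply: le_trans (qform_le _ _) _ => //; rewrite ler_wpM2r ?energy_ge0// hc.
rewrite (_ : q (F n) (G n) - q f g = q (F n) (G n - g) + (q (F n) g - q f g)); last first.
  by rewrite (si_Br qsi)//; ring.
apply: le_lt_trans (ler_normD _ _) _; apply: le_lt_trans (lerD k3 (ltW k1)) _.
rewrite -ltrBrDr (_ : e - e / 2 = (c + 1) * (e / (2 * (c + 1)))); last first.
  by field; rewrite gt_eqF// ltr_wpDl.
apply: le_lt_trans (_ : (c + 1) * energy (G n - g) < _).
  by rewrite ler_wpM2r ?energy_ge0// lerDl.
by rewrite ltr_pM2l// ltr_wpDl.
Qed.

(** Neither limit is assumed finitely supported, so [q (F n) (G n)] is compared with
    [dot m (tau f) (G n)], the limit of [q (F k) (G n)] in [k]; the Cauchy property of [F] and the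
    bounded energy of [G] control the error. *)
Lemma approx_cvg_form F f G g : approx F f -> approx G g -> ell2 m (tau f) ->
  (fun n => q (F n) (G n)) @ \oo --> dot m (tau f) g.
Proof.
move=> hF hGg t2; have [N [c [c0 hc]]] := approx_bounded hGg.
have [F0 _ _ Fq] := hF; have [G0 _ _ _] := hGg.
have /cvgn_epsP l := approx_cvg_ell2 hGg t2.
apply/cvgn_epsP => e ep.
have cp : 0 < 2 * (c + 1) by rewrite mulr_gt0// ltr_wpDl.
have [|M1 h1] := l (e / 2); first by rewrite divr_gt0.
have [|M2 h2] := Fq (e / (2 * (c + 1))); first by rewrite divr_gt0.
exists (maxn N (maxn M1 M2)) => n; rewrite !geq_max => /and3P[Nn M1n M2n].
have k1 := h1 n M1n.
have k2 : `|q (F n) (G n) - dot m (tau f) (G n)| <= e / (2 * (c + 1)) * c.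
  have lim : (fun k => `|q (F n) (G n) - q (F k) (G n)|) @ \oo -->
      `|q (F n) (G n) - q f (G n)|.
    apply: cvg_norm; apply: (@cvgB R R nat); first exact: cvg_cst.
    exact: approx_cvg_qform.
  apply: (cvg_le (N := M2) lim) => k M2k.
  rewrite -(si_Bl qsi)//; apply: le_trans (qform_le _ _) _ => //.
    exact: fin_suppB.
  by apply: ler_pM; [exact: energy_ge0|exact: energy_ge0|exact/ltW/h2|exact: hc].
rewrite (_ : _ - _ = (q (F n) (G n) - dot m (tau f) (G n)) +
  (dot m (tau f) (G n) - dot m (tau f) g)); last by ring.
apply: le_lt_trans (ler_normD _ _) _; apply: le_lt_trans (lerD k2 (lexx _)) _.
rewrite -ltrBrDl; apply: lt_le_trans k1 _.
rewrite lerBrDl -lerBrDr (_ : e - e / 2 = e / (2 * (c + 1)) * (c + 1)); last first.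
  by field; rewrite gt_eqF// ltr_wpDl.
by rewrite ler_wpM2l ?lerDl// divr_ge0// ltW.
Qed.

(** The form domain. The operator domain consists of those [f] in it for which [tau f] is
    square-summable. *)
Definition dom f := exists F, approx F f.

(** Test functions carried by one vertex force [w] to be the pointwise [tau f]. Conversely,
    [approx_cvg_form] supplies the real part of the defining identity and, applied to [i g], the
    imaginary part along the same sequences. *)
Lemma laplacianP f w :
  laplacian adj m b (f, w) <-> [/\ dom f, ell2 m w & w = tau f].
Proof.
have domE g : form_dom m (@fin_supp R V) tau g <-> dom g.
  split=> [[g2 [F /(approxP _ g2) hF]]|[F hF]]; first by exists F.
  by have [_ g2 _ _] := hF; split=> //; exists F; apply/approxP.
split.
  move=> [/domE[F0 hF0] /= w2 h]; split=> //; first by exists F0.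
  have [_ f2 _ _] := hF0.
  have eq g : fin_supp g -> dot m w g = q f g.
    move=> g0; have g2 := fs_ell2 g0.
    have [|F [G [/(approxP _ f2) hF /(approxP _ g2) hGg /cvg_Re lim]]] := h g.
      by apply/domE; exists (fun=> g); exact: approx_const.
    move: lim; rewrite (inner_dot m w g) => lim.
    apply: (norm_cvg_unique _ (approx_cvg_qform2 hF hGg g0)).
    by apply: cvg_ext lim => n; rewrite inner_dot.
  apply/funext => v; apply/eqP; rewrite -subr_eq0; apply/eqP/cdot_eq0/eqP.
  (* Testing against the defect at [v] itself yields its squared modulus. *)
  have := eq _ (fin_supp_restr [fset v]%fset (w - tau f)).
  rewrite /qform -/(restr1 v (w - tau f)) !dot_restr1 => /(mulIf (lt0r_neq0 (m_gt0 v))).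
  by move=> e; rewrite cdotBl e subrr.
move=> [[F hF] w2 wt]; split=> //=; first by apply/domE; exists F.
move=> g /domE[G hGg]; exists F, G.
have [_ f2 _ _] := hF; have [_ g2 _ _] := hGg.
split; try exact/approxP.
subst w; rewrite inner_dot; apply: cvg_complex.
  apply: cvg_ext (approx_cvg_form hF hGg w2) => n; by rewrite inner_dot.
apply: cvg_ext (approx_cvg_form hF (approxM 'i hGg) w2) => n; by rewrite inner_dot.
Qed.

Lemma dom_ell2 f : dom f -> ell2 m f.
Proof. by move=> [F []]. Qed.

Lemma domM z f : dom f -> dom (z \*o f).
Proof. by move=> [F hF]; exists (fun n => z \*o F n); exact: approxM. Qed.

Lemma domD f g : dom f -> dom g -> dom (f + g).
Proof. by move=> [F hF] [G hGg]; exists (fun n => F n + G n); exact: approxD. Qed.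

Lemma domB f g : dom f -> dom g -> dom (f - g).
Proof. by move=> [F hF] [G hGg]; exists (fun n => F n - G n); exact: approxB. Qed.

Lemma dom0 : dom 0.
Proof.
exists (fun=> 0); apply: approx_const; apply/fin_suppP; exists fset0 => v.
by rewrite eqxx.
Qed.

Lemma dom_sum (I : Type) (r : seq I) (F : I -> V -> R[i]) :
  (forall i, dom (F i)) -> dom (\sum_(i <- r) F i).
Proof.
by move=> h; elim/big_ind: _ => //; [exact: dom0|move=> x y; exact: domD].
Qed.

(** Both sides are limits of the same numbers [q (F n) (G n)]. *)
Lemma tau_symmetric f g : dom f -> dom g -> ell2 m (tau f) -> ell2 m (tau g) ->
  dot m (tau f) g = dot m f (tau g).
Proof.
move=> [F hF] [G hGg] tf tg; have [F0 _ _ _] := hF; have [G0 _ _ _] := hGg.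
apply: (norm_cvg_unique (approx_cvg_form hF hGg tf)).
rewrite dotC; apply: cvg_ext (approx_cvg_form hGg hF tg) => n.
by rewrite (si_sym qsi).
Qed.

Lemma approx_cvg_dot F f : approx F f ->
  (fun n => dot m (F n) (F n)) @ \oo --> dot m f f.
Proof.
move=> hF; have [F0 f2 Fc _] := hF; apply/cvg_sub0.
have F2 n : ell2 m (F n) := fs_ell2 (F0 n).
apply: (@cvg_ext _ _ (fun n => nrm m (F n - f) * nrm m (F n - f) +
   2 * (dot m f (F n) - dot m f f))).
  move=> n; rewrite -expr2 nrm_sqr//; last exact: ell2B.
  by rewrite (si_sqrB dsi)// (dotC _ (F n) f); ring.
have h1 : (fun n => nrm m (F n - f) * nrm m (F n - f)) @ \oo --> (0 : R) * 0 by exact: cvgM.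
have /cvg_sub0 h2 := approx_cvg_ell2 hF f2.
have h3 : (fun n => 2 * (dot m f (F n) - dot m f f)) @ \oo --> (0 : R).
  exact: (@cvg_bounded0 _ (fun=> 2) _ `|2|).
have : (fun n => nrm m (F n - f) * nrm m (F n - f) +
   2 * (dot m f (F n) - dot m f f)) @ \oo --> (0 : R) * 0 + 0 by exact: cvgD.
by rewrite mulr0 addr0.
Qed.

Lemma approx_cvg_fset F f (X : {fset V}) : approx F f ->
  (fun n => \sum_(v <- X) cdot (F n v) (F n v) * m v) @ \oo -->
  \sum_(v <- X) cdot (f v) (f v) * m v.
Proof.
move=> hF; have [F0 f2 Fc _] := hF.
have F2 n : ell2 m (F n) := fs_ell2 (F0 n).
apply: cvg_sumr => v; apply: cvgM; last exact: cvg_cst.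
have pc (p : R[i] -> R) : (forall x y, p (x - y) = p x - p y) ->
    (forall x, `|p x| <= Normc.normc x) -> (fun n => p (F n v)) @ \oo --> p (f v).
  move=> pB pn; apply/cvg_sub0.
  apply: (@cvg_le_cvg0 _ _ (fun n => (Num.sqrt (m v))^-1 * nrm m (F n - f))).
    move=> n; rewrite -pB; apply: le_trans (pn _) _; rewrite mulrC.
    by apply: (normc_le_nrm m_gt0 v (f := F n - f)); exact: ell2B.
  by apply: (@cvg_bounded0 _ _ _ `|(Num.sqrt (m v))^-1|).
have h1 := pc _ (@ReB R) (@Re_le_normc R); have h2 := pc _ (@ImB R) (@Im_le_normc R).
by apply: cvgD; apply: cvgM.
Qed.

Lemma dom_lower_bound (l c : R) (X : {fset V}) f :
  (forall h, fin_supp h ->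
    l * dot m h h <= q h h + c * \sum_(v <- X) cdot (h v) (h v) * m v) ->
  dom f -> ell2 m (tau f) ->
  l * dot m f f <= dot m (tau f) f + c * \sum_(v <- X) cdot (f v) (f v) * m v.
Proof.
move=> hl [F hF] tf; have [F0 _ _ _] := hF.
have h1 := approx_cvg_form hF hF tf.
have h2 : (fun n => c * \sum_(v <- X) cdot (F n v) (F n v) * m v) @ \oo -->
    c * \sum_(v <- X) cdot (f v) (f v) * m v.
  by apply: cvgM; [exact: cvg_cst|exact: approx_cvg_fset].
have h3 : (fun n => l * dot m (F n) (F n)) @ \oo --> l * dot m f f.
  by apply: cvgM; [exact: cvg_cst|exact: approx_cvg_dot].
have h4 : (fun n => q (F n) (F n) + c * (\sum_(v <- X) cdot (F n v) (F n v) * m v)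
    - l * dot m (F n) (F n)) @ \oo --> dot m (tau f) f +
    c * (\sum_(v <- X) cdot (f v) (f v) * m v) - l * dot m f f.
  by apply: cvgB => //; apply: cvgD.
rewrite -subr_ge0; apply: (cvg_ge (N := 0%N) h4) => n _.
by rewrite subr_ge0; exact: hl.
Qed.

End Friedrichs.

(** * Resolvents *)

(** The first-order condition at a minimum. The minimizer would be [t = - x / y]; the test value has
    [y + 1] instead, to cover [y = 0]. *)
Lemma quad_ge0_eq0 (R : realFieldType) (x y : R) : 0 <= y ->
  (forall t, 0 <= 2 * t * x + t ^+ 2 * y) -> x = 0.
Proof.
move=> y0 /(_ (- x / (y + 1))) h.
have y1 : 0 < y + 1 by rewrite ltr_wpDl.
have : 0 <= (y + 1) ^+ 2 * (2 * (- x / (y + 1)) * x + (- x / (y + 1)) ^+ 2 * y).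
  by rewrite mulr_ge0// sqr_ge0.
rewrite [X in 0 <= X](_ : _ = - (x ^+ 2 * (y + 2))); last by field; rewrite gt_eqF.
rewrite oppr_ge0 pmulr_lle0 ?ltr_wpDl// => x0.
by apply/eqP; rewrite -sqrf_eq0 eq_le x0 sqr_ge0.
Qed.

(** * Real spectral parameters: energy minimization *)

Section RealResolvent.
Variables (R : realType) (V : choiceType) (adj : rel V).
Variables (m : V -> R) (b : V -> V -> R).
Hypotheses (hG : is_graph adj) (hw : is_weight adj m b).
Implicit Types (F G : nat -> V -> R[i]) (f g h w : V -> R[i]) (z : R[i]).

Let m_gt0 := weight_vertex_gt0 hw.
Let dsi := dot_semi_inner m_gt0.
Let qsi := qform_semi_inner hG hw.

Local Notation tau := (tau adj m b).
Local Notation q := (qform adj m b).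
Local Notation dom := (dom adj m b).

Variables (l c : R) (X : {fset V}).
Hypotheses (c_ge0 : 0 <= c).
Hypothesis hl : forall h, fin_supp h ->
  l * dot m h h <= q h h + c * \sum_(v <- X) cdot (h v) (h v) * m v.

Definition potential f : V -> R[i] := rscale c (restr X f).

Lemma potentialD f g : potential (f + g) = potential f + potential g.
Proof.
apply/funext => v; rewrite fun_addE /potential /rscale /= /restr fun_addE.
by case: ifP => _; rewrite ?mulrDr ?mulr0 ?addr0.
Qed.

Lemma potentialZ z f : potential (z \*o f) = z \*o potential f.
Proof.
apply/funext => v; rewrite /potential /rscale /= /restr.
by case: ifP => _ /=; rewrite ?mulr0// mulrCA.
Qed.

Lemma dot_potential f g : dot m (potential f) g = c * \sum_(v <- X) cdot (f v) (g v) * m v.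
Proof.
rewrite (@dot_finite _ _ m _ _ X); last first.
  move=> v; rewrite /potential /rscale /= /restr; case: ifP => // _.
  by rewrite mulr0 eqxx.
rewrite mulr_sumr; apply: eq_big_seq => v vX.
by rewrite /potential /rscale /= /restr vX cdotZl mulrA.
Qed.

Lemma fin_supp_potential f : fin_supp (potential f).
Proof. by apply: fin_suppM; exact: fin_supp_restr. Qed.

Lemma potential_ell2 f : ell2 m (potential f).
Proof. exact: (fin_supp_ell2 hw (fin_supp_potential f)). Qed.

Lemma dot_potential_ge0 f : 0 <= dot m (potential f) f.
Proof.
by rewrite dot_potential mulr_ge0// sumr_ge0// => v _; exact: (cdotm_ge0 m_gt0).
Qed.

Lemma dot_potentialC f g : dot m (potential f) g = dot m (potential g) f.
Proof.
by rewrite !dot_potential; congr (_ * _); apply: eq_bigr => v _; rewrite cdotC.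
Qed.

(** Pairing the equation with [f] in the real inner product leaves only the real part of [z]; the
    lower bound [l] and Cauchy-Schwarz do the rest. *)
Lemma resolvent_bound z f g : complex.Re z < l -> dom f -> ell2 m (tau f) ->
  tau f + potential f - z \*o f = g -> (l - complex.Re z) * nrm m f <= nrm m g.
Proof.
move=> zl df tf <-; have f2 := dom_ell2 df.
have p2 := potential_ell2 f; have z2 := ell2M m_gt0 z f2.
have t2 := ell2D m_gt0 tf p2.
have w2 := ell2B m_gt0 t2 z2.
have h : (l - complex.Re z) * dot m f f <= dot m (tau f + potential f - z \*o f) f.
  rewrite dotBl// dotDl// dotM_self// mulrBl lerD2r dot_potential.
  exact: dom_lower_bound hl df tf.
have [f0|f0] := eqVneq (nrm m f) 0; first by rewrite f0 mulr0 nrm_ge0.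
have fp : 0 < nrm m f by rewrite lt_def f0 nrm_ge0.
rewrite -(ler_pM2r fp) -mulrA -expr2 nrm_sqr//.
apply: le_trans h _; apply: le_trans (ler_norm _) _; exact: dot_le.
Qed.

Section Minimization.
Variables (s : R) (g : V -> R[i]).
Hypotheses (sl : s < l) (g2 : ell2 m g).

Definition sform h k := q h k + dot m (potential h) k - s * dot m h k.

Let f2 h : fin_supp h -> ell2 m h.
Proof. exact: (fin_supp_ell2 hw). Qed.

Lemma sform_coercive h : fin_supp h -> (l - s) * dot m h h <= sform h h.
Proof.
by move=> h0; rewrite /sform mulrBl lerD2r dot_potential; exact: hl.
Qed.

Let k_gt0 : 0 < l - s. Proof. by rewrite subr_gt0. Qed.

Lemma sform_semi_inner : semi_inner (@rscale R V) (@fin_supp R V) sform.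
Proof.
split; [exact: (si_in qsi)|exact: (si_sc1 qsi)|exact: (si_scN1 qsi)|..].
- move=> a x y k x0 y0 k0; rewrite /sform (si_lin qsi)// potentialD potentialZ.
  rewrite (si_lin dsi a (potential_ell2 x) (potential_ell2 y) (f2 k0)).
  by rewrite (si_lin dsi a (f2 x0) (f2 y0) (f2 k0)); ring.
- by move=> x y x0 y0; rewrite /sform (si_sym qsi x0 y0) dot_potentialC (dotC _ x).
- move=> x x0; apply: le_trans (sform_coercive x0).
  by rewrite mulr_ge0 ?(ltW k_gt0)// dot_ge0//; exact: f2.
Qed.

Let ssi := sform_semi_inner.

Lemma qform_le_sform h : fin_supp h -> q h h <= (1 + `|s| / (l - s)) * sform h h.
Proof.
move=> h0; have h1 := sform_coercive h0; have h2 := dot_potential_ge0 h.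
have N0 := dot_ge0 m_gt0 (f2 h0).
have h3 : s * dot m h h <= `|s| * dot m h h by rewrite ler_wpM2r// ler_norm.
have h4 : `|s| * dot m h h <= `|s| / (l - s) * sform h h.
  by rewrite -mulrA ler_wpM2l// ler_pdivlMl.
rewrite mulrDl mul1r; apply: le_trans (lerD (lexx _) h4).
by apply: le_trans (lerD (lexx _) h3); rewrite /sform; lra.
Qed.

(** Dirichlet's principle: its stationarity condition is the weak form of
    [tau f + potential f - s f = g]. *)
Definition energy_fun h := sform h h - 2 * dot m g h.

Local Notation J := energy_fun.

Lemma energy_fun_bounded h : fin_supp h -> - ((l - s)^-1 * dot m g g) <= J h.
Proof.
move=> h0; have h1 := sform_coercive h0.
have h2 := dot_le m_gt0 g2 (f2 h0).
have h3 := weighted_amgm (nrm m h) (nrm m g) (_ : 0 < (l - s)^-1).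
rewrite invr_gt0 invrK !nrm_sqr// in h3; last exact: f2.
have {}h3 := h3 k_gt0.
have h4 := ler_norm (dot m g h).
by rewrite /energy_fun; nra.
Qed.

Let vals := [set J h | h in @fin_supp R V].

Lemma energy_fun_has_inf : has_inf vals.
Proof.
split.
  exists (J 0), 0 => //; apply/fin_suppP; exists fset0 => v.
  by rewrite eqxx.
by exists (- ((l - s)^-1 * dot m g g)) => _ [h h0 <-]; exact: energy_fun_bounded.
Qed.

Lemma minimizing_seq : exists F, forall n, fin_supp (F n) /\
  J (F n) < inf vals + n.+1%:R^-1.
Proof.
have ex (n : nat) : exists h, fin_supp h /\ J h < inf vals + n.+1%:R^-1.
  have [|_ [h h0 <-] hJ] := @inf_adherent _ vals n.+1%:R^-1 _ energy_fun_has_inf.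
    by rewrite invr_gt0.
  by exists h.
by have [F hF] := choice ex; exists F.
Qed.

Lemma inf_le_energy h : fin_supp h -> inf vals <= J h.
Proof.
move=> h0; apply: ge_inf; last by exists h.
by case: energy_fun_has_inf.
Qed.

(** By the parallelogram identity, [J h + J k] exceeds twice the value of [J] at the midpoint by
    half of [sform (h - k) (h - k)]; hence almost minimizing functions are close to each other. *)
Lemma sform_midpoint h k : fin_supp h -> fin_supp k ->
  sform (h - k) (h - k) <= 2 * (J h - inf vals) + 2 * (J k - inf vals).
Proof.
move=> h0 k0; pose M := rscale 2^-1 (h + k).
have hk0 : fin_supp (h + k) by exact: fin_suppD.
have M0 : fin_supp M by exact: fin_suppM.
have M2 : M + M = h + k.
  apply/funext => v; rewrite fun_addE /M /rscale /= -mulrDl -rmorphD/=.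
  rewrite (_ : 2^-1 + 2^-1 = 1 :> R) ?mul1r//; by field.
have e1 : sform (h + k) (h + k) = 4 * sform M M.
  by rewrite -M2 (si_sqrD ssi)//; ring.
have e2 : dot m g h + dot m g k = 2 * dot m g M.
  rewrite -(si_Dr dsi (f2 h0) (f2 k0) g2) -M2 (si_Dr dsi)//; try exact: f2.
  by ring.
have := inf_le_energy M0; move: e1; rewrite /energy_fun.
rewrite (si_sqrD ssi)// (si_sqrB ssi)//; lra.
Qed.

(** A minimizing sequence is Cauchy for [sform], hence by coercivity in norm and in energy, so its
    limit lies in the form domain. The equation is then read off from the first variation at each
    vertex. *)
Lemma real_resolvent : exists2 f, dom f & tau f + potential f - s%:C \*o f = g.
Proof.
have [F hF] := minimizing_seq.
have F0 n : fin_supp (F n) by case: (hF n).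
have FJ n : J (F n) - inf vals < n.+1%:R^-1 by rewrite ltrBlDl; case: (hF n).
have small e : 0 < e -> exists N, forall n, (N <= n)%N -> n.+1%:R^-1 < e :> R.
  move=> e0; have /cvgn_epsP/(_ _ e0)[N hN] := @cvg_harmonic R.
  by exists N => n /hN; rewrite subr0 ger0_norm// invr_ge0.
have cau e : 0 < e -> exists N, forall i j, (N <= i)%N -> (N <= j)%N ->
    sform (F i - F j) (F i - F j) < e.
  move=> e0; have [|N hN] := small (e / 4); first by rewrite divr_gt0.
  exists N => i j Ni Nj; apply: le_lt_trans (sform_midpoint (F0 i) (F0 j)) _.
  have := lt_trans (FJ i) (hN i Ni); have := lt_trans (FJ j) (hN j Nj); lra.
have F2 n := f2 (F0 n).
have [|f [ff2 Fc _]] := ell2_complete m_gt0 F2.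
  move=> e e0; have [|N hN] := cau ((l - s) * e ^+ 2).
    by rewrite mulr_gt0// exprn_gt0.
  exists N => i j Ni Nj.
  have ij0 : fin_supp (F i - F j) by exact: fin_suppB.
  rewrite -(ltr_pXn2r (n := 2)) ?nnegrE ?nrm_ge0 ?(ltW e0)//.
  rewrite nrm_sqr//; last exact: f2.
  rewrite -(ltr_pM2l k_gt0); apply: le_lt_trans (hN i j Ni Nj).
  exact: sform_coercive.
have hFf : approx adj m b F f.
  split=> // e e0.
  have K0 : 0 < 1 + `|s| / (l - s) by rewrite ltr_wpDr// divr_ge0// ltW.
  have [|N hN] := cau (e ^+ 2 / (1 + `|s| / (l - s))).
    by rewrite divr_gt0// exprn_gt0.
  exists N => i j Ni Nj.
  have ij0 : fin_supp (F i - F j) by exact: fin_suppB.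
  rewrite -(ltr_pXn2r (n := 2)) ?nnegrE ?energy_ge0 ?(ltW e0)//.
  rewrite (energy_sqr hG hw)//; apply: le_lt_trans (qform_le_sform ij0) _.
  by rewrite mulrC -ltr_pdivlMr//; exact: hN.
exists f; first by exists F.
apply/funext => v; apply/eqP; rewrite eq_sym -subr_eq0; apply/eqP/cdot_eq0.
set w := g - (tau f + potential f - s%:C \*o f).
change (cdot (w v) (w v) = 0).
(* The test function carries the defect [w v]; stationarity against it says that [|w v|^2 * m v] is
   zero. *)
pose h := restr1 v w; have h0 : fin_supp h by exact: fin_supp_restr.
pose A := q f h + dot m (potential f) h - s * dot m f h.
have cA : (fun n => sform (F n) h) @ \oo --> A.
  apply: (@cvgB R R nat); first apply: (@cvgD R R nat).
  - exact: approx_cvg_qform hFf h0.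
  - rewrite dot_potentialC; apply: cvg_ext (approx_cvg_ell2 hw hFf (potential_ell2 h)) => n.
    exact: dot_potentialC.
  - apply: cvgM; first exact: cvg_cst.
    rewrite dotC; apply: cvg_ext (approx_cvg_ell2 hw hFf (f2 h0)) => n.
    exact: dotC.
(* Since [f] need not be finitely supported, the variation is taken along the sequence: [J (F n + t
   h) >= inf vals > J (F n) - 1/(n+1)], and the slack disappears in the limit. *)
have A0 : A - dot m g h = 0.
  apply: (@quad_ge0_eq0 _ _ (sform h h) (si_ge0 ssi h0)) => t.
  have lim : (fun n => 2 * t * (sform (F n) h - dot m g h) + t ^+ 2 * sform h h +
      n.+1%:R^-1) @ \oo --> 2 * t * (A - dot m g h) + t ^+ 2 * sform h h + 0.
    apply: (@cvgD R R nat); last exact: cvg_harmonic.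
    apply: (@cvgD R R nat); last exact: cvg_cst.
    apply: cvgM; first exact: cvg_cst.
    by apply: (@cvgB R R nat) => //; exact: cvg_cst.
  rewrite -[leRHS]addr0; apply: (cvg_ge (N := 0%N) lim) => n _.
  have Fh0 : fin_supp (F n + rscale t h) by apply: (si_in qsi).
  have := inf_le_energy Fh0; have := FJ n; rewrite /energy_fun.
  rewrite (si_sqr_lin ssi)// [dot m g (_ + _)]dotC (si_lin dsi)//; try exact: f2.
  rewrite !(dotC _ _ g).
  by move: (n.+1%:R^-1 : R) (inf vals) => e j k1 k2; move: k2 k1; lra.
have := A0; rewrite /A /qform !dot_restr1 => {}A0.
have : cdot (w v) (w v) * m v = 0; last first.
  by move/eqP; rewrite mulf_eq0 (gt_eqF (m_gt0 v)) orbF => /eqP.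
rewrite -oppr0 -A0 {1}/w; set W := w v.
rewrite [(g - _) v](_ : _ = g v - (tau f v + potential f v - s%:C * f v))//.
by rewrite !cdotBl cdotDl cdotZl; ring.
Qed.

End Minimization.
End RealResolvent.

(** * Complex spectral parameters: contraction *)

Section ComplexResolvent.
Variables (R : realType) (V : choiceType) (adj : rel V).
Variables (m : V -> R) (b : V -> V -> R).
Hypotheses (hG : is_graph adj) (hw : is_weight adj m b).
Implicit Types (f g h w : V -> R[i]) (z : R[i]).

Let m_gt0 := weight_vertex_gt0 hw.

Local Notation tau := (tau adj m b).
Local Notation q := (qform adj m b).
Local Notation dom := (dom adj m b).

Variables (l c : R) (X : {fset V}).
Hypotheses (c_ge0 : 0 <= c).
Hypothesis hl : forall h, fin_supp h ->
  l * dot m h h <= q h h + c * \sum_(v <- X) cdot (h v) (h v) * m v.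

Local Notation potential := (potential c X).

(** Membership in the form domain is enough here: for square-summable [g] the equation itself makes
    [tau f] square-summable. *)
Definition resolves z f g := dom f /\ tau f + potential f - z \*o f = g.

Lemma resolves_tau z f g : ell2 m g -> resolves z f g -> ell2 m (tau f).
Proof.
move=> g2 [df E]; have f2 := dom_ell2 df.
rewrite (_ : tau f = g + z \*o f - potential f).
  apply: ell2B => //; last exact: (potential_ell2 hw).
  by apply: ell2D => //; exact: ell2M.
by rewrite -E; apply/funext => v; rewrite !funE; ring.
Qed.

Lemma fun_mulD z f g : z \*o (f + g) = z \*o f + z \*o g.
Proof. by apply/funext => v; rewrite !funE mulrDr. Qed.

Lemma fun_mulN z f : z \*o (- f) = - (z \*o f).
Proof. by apply/funext => v; rewrite !funE mulrN. Qed.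

Lemma resolvesD z f g f' g' : resolves z f g -> resolves z f' g' ->
  resolves z (f + f') (g + g').
Proof.
move=> [df <-] [df' <-]; split; first exact: (domD hG hw).
by rewrite (tauD hG hw) potentialD; apply/funext => v; rewrite !funE; ring.
Qed.

Lemma resolvesM z a f g : resolves z f g -> resolves z (a \*o f) (a \*o g).
Proof.
move=> [df <-]; split; first exact: (domM hG hw).
by rewrite (tauZ hG hw) potentialZ; apply/funext => v; rewrite !funE; ring.
Qed.

Lemma resolvesB z f g f' g' : resolves z f g -> resolves z f' g' ->
  resolves z (f - f') (g - g').
Proof.
have E x : - x = (-1) \*o x :> (V -> R[i]) by apply/funext => v; rewrite /= mulN1r.
by move=> h h'; rewrite !(E f') !(E g'); apply: resolvesD => //; exact: resolvesM.
Qed.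

Lemma resolves_sum z (I : Type) (r : seq I) (F G : I -> V -> R[i]) :
  (forall i, resolves z (F i) (G i)) -> resolves z (\sum_(i <- r) F i) (\sum_(i <- r) G i).
Proof.
move=> h; elim: r => [|i r IH]; last by rewrite !big_cons; exact: resolvesD.
rewrite !big_nil; split; first exact: (dom0 hw).
have t0 : tau 0 = 0 by rewrite -{1}(subrr 0) (tauB hG hw) subrr.
apply/funext => v; rewrite t0 !funE /potential /rscale /= /restr.
by rewrite if_same !mulr0 !add0r oppr0.
Qed.

Lemma resolves_bound z f g : complex.Re z < l -> ell2 m g -> resolves z f g ->
  (l - complex.Re z) * nrm m f <= nrm m g.
Proof.
move=> zl g2 h; have tf := resolves_tau g2 h; have [df E] := h.
exact: (resolvent_bound hG hw hl zl df tf E).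
Qed.

Lemma resolves_inj z f f' g : complex.Re z < l -> ell2 m g -> resolves z f g ->
  resolves z f' g -> f = f'.
Proof.
move=> zl g2 h h'; have := resolvesB h h'; rewrite subrr => h0.
apply/eqP; rewrite -subr_eq0; apply/eqP/(nrm_eq0 m_gt0).
  by apply: ell2B => //; apply: (dom_ell2 (b := b) (adj := adj)); [case: h|case: h'].
have := resolves_bound zl (ell20 m_gt0) h0; rewrite nrm0 pmulr_rle0 ?subr_gt0// => n0.
by apply/eqP; rewrite eq_le n0 nrm_ge0.
Qed.

(** Open discs centred on the real axis and tangent to the line [Re = l] exhaust the half-plane to
    its left. For [z = x + i y] and [r = x - s] the condition is
    [y ^+ 2 < (l - x) ^+ 2 + 2 * r * (l - x)], and [r] is chosen so that the last term equals
    [y ^+ 2]. *)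
Lemma shift_contraction z : complex.Re z < l -> exists2 s : R, s < l &
  Normc.normc (z - s%:C) < l - s.
Proof.
case: z => x y /= xl; have k0 : 0 < l - x by rewrite subr_gt0.
exists (x - y ^+ 2 / (2 * (l - x))).
  rewrite ltrBlDr; apply: lt_le_trans xl _; rewrite lerDl.
  by rewrite divr_ge0 ?sqr_ge0// mulr_ge0// ltW.
set r := y ^+ 2 / _; have r0 : 0 <= r by rewrite divr_ge0 ?sqr_ge0// mulr_ge0// ltW.
have E : y ^+ 2 = 2 * r * (l - x) by rewrite /r; field; rewrite gt_eqF.
rewrite -(ltr_pXn2r (n := 2)) ?nnegrE ?sqrtr_ge0//; last by lra.
rewrite sqr_sqrtr ?addr_ge0 ?sqr_ge0// subr0 E; nra.
Qed.

(* Banach iteration for [f = (h - s)^-1 (g + (z - s) f)]. *)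
Lemma complex_resolvent z g : complex.Re z < l -> ell2 m g ->
  exists f, resolves z f g.
Proof.
move=> /shift_contraction[s sl hs] g2.
set w := z - s%:C in hs; set k := Normc.normc w / (l - s).
have ls0 : 0 < l - s by rewrite subr_gt0.
have k0 : 0 <= k.
  by rewrite divr_ge0 ?(ltW ls0)//; case: (w) => ? ? /=; rewrite sqrtr_ge0.
have k1 : k < 1 by rewrite ltr_pdivrMr// mul1r.
(* The implication makes the chosen solution map total; its values on other data are irrelevant. *)
have ex x : exists f, ell2 m x -> resolves s%:C f x.
  have [x2|x2] := pselect (ell2 m x); last by exists 0 => /x2.
  by have [f df E] := real_resolvent hG hw c_ge0 hl sl x2; exists f => _; split.
have [S hS] := choice ex.
have S2 x : ell2 m x -> ell2 m (S x) by move=> /hS[/dom_ell2].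
pose step f := S (g + w \*o f).
have arg2 f : ell2 m f -> ell2 m (g + w \*o f).
  by move=> f2; apply: ell2D => //; exact: ell2M.
have contr f f' : ell2 m f -> ell2 m f' ->
    nrm m (step f - step f') <= k * nrm m (f - f').
  move=> f2 f2'; have := resolvesB (hS _ (arg2 _ f2)) (hS _ (arg2 _ f2')).
  rewrite opprD addrACA subrr add0r -fun_mulN -fun_mulD => h.
  have d2 : ell2 m (f - f') by exact: ell2B.
  have := resolves_bound (z := s%:C) sl (ell2M m_gt0 w d2) h.
  by rewrite nrmM// /k mulrAC ler_pdivlMr// mulrC.
pose F n := iter n step 0.
have F2 n : ell2 m (F n).
  elim: n => [|n IH]; [exact: ell20|exact/S2/arg2].
(* [M] solves [k * M + nrm m (F 1) = M], so the iteration stays in the ball of radius [M]. *)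
pose M := nrm m (F 1%N) / (1 - k).
have M0 : 0 <= M by rewrite divr_ge0 ?nrm_ge0// subr_ge0 ltW.
have FM n : nrm m (F n) <= M.
  elim: n => [|n IH]; first by rewrite nrm0.
  rewrite -[F n.+1](subrK (F 1%N)).
  apply: le_trans (nrmD m_gt0 _ _) _ => //; first exact: ell2B.
  apply: le_trans (lerD (contr _ _ (F2 n) (F2 0%N)) (lexx _)) _.
  rewrite subr0; apply: le_trans (lerD (ler_wpM2l k0 IH) (lexx _)) _.
  rewrite le_eqVlt /M; apply/orP; left; apply/eqP; field.
  by rewrite subr_eq0 gt_eqF.
have Fk n i : nrm m (F (n + i)%N - F n) <= k ^+ n * M.
  elim: n => [|n IH]; first by rewrite subr0 expr0 mul1r add0n.
  rewrite addSn exprS -mulrA; apply: le_trans (contr _ _ (F2 _) (F2 _)) _.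
  exact: ler_wpM2l.
have [|f [f2 Fc _]] := ell2_complete m_gt0 F2.
  move=> e e0; have : (fun n => k ^+ n * M) @ \oo --> (0 : R) * M.
    apply: cvgM; last exact: cvg_cst.
    by apply: cvg_expr; rewrite ger0_norm.
  rewrite mul0r => /cvgn_epsP/(_ (e / 2)) [|N hN]; first by rewrite divr_gt0.
  exists N => i j Ni Nj; have := hN N (leqnn N); rewrite subr0 ger0_norm; last first.
    by rewrite mulr_ge0// exprn_ge0.
  have := Fk N (i - N)%N; have := Fk N (j - N)%N; rewrite !subnKC// => hj hi hk.
  rewrite (_ : F i - F j = (F i - F N) - (F j - F N)); last first.
    by rewrite opprB addrA subrK.
  apply: le_lt_trans (nrmB m_gt0 _ _) _; try exact: ell2B.
  lra.
have sf2 : ell2 m (step f) by exact/S2/arg2.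
(* A fixed point solves the equation at [s] with data [g + (z - s) f], which is the equation at [z]
   with data [g]. *)
suff E : f = step f.
  exists f; have := hS _ (arg2 _ f2); rewrite -/(step f) -E => -[df e]; split=> //.
  apply/funext => v; have /(congr1 (fun h => h v)) := e.
  rewrite !funE /w => e'.
  rewrite (_ : g v = g v + (z - s%:C) * f v - (z - s%:C) * f v); last by ring.
  by rewrite -e'; ring.
apply/eqP; rewrite -subr_eq0; apply/eqP/(nrm_eq0 m_gt0); first exact: ell2B.
apply/eqP; rewrite eq_le nrm_ge0 andbT.
have lim : (fun n => k * nrm m (F n - f) + nrm m (F n.+1 - f)) @ \oo --> k * 0 + (0 : R).
  apply: cvgD; first by apply: cvgM => //; exact: cvg_cst.
  by rewrite (cvg_shiftS (fun n => nrm m (F n - f))).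
rewrite mulr0 addr0 in lim; apply: (cvg_ge (N := 0%N) lim) => n _.
rewrite (_ : f - step f = (F n.+1 - step f) - (F n.+1 - f)); last first.
  by apply/funext => v; rewrite !funE; ring.
apply: le_trans (nrmB m_gt0 _ _) _; try exact: ell2B.
by rewrite lerD2r; exact: contr.
Qed.

End ComplexResolvent.

(** * Spectrum below the isoperimetric bound *)

Section Spectral.
Variables (R : realType) (V : choiceType) (adj : rel V).
Variables (m : V -> R) (b : V -> V -> R).
Hypotheses (hG : is_graph adj) (hw : is_weight adj m b).
Implicit Types (f g h w : V -> R[i]) (z : R[i]).

Let m_gt0 := weight_vertex_gt0 hw.

Local Notation tau := (tau adj m b).
Local Notation q := (qform adj m b).
Local Notation dom := (dom adj m b).
Local Notation T := (laplacian adj m b).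

Definition eigen z f := dom f /\ tau f = z \*o f.

Lemma eigenspaceP z f : Defs.eigenspace T z f <-> eigen z f.
Proof.
split=> [/(laplacianP hG hw)[df _ e]|[df tf]]; first by split.
by apply/(laplacianP hG hw); split=> //; apply: ell2M => //; exact: dom_ell2 df.
Qed.

Lemma eigenM z a f : eigen z f -> eigen z (a \*o f).
Proof.
move=> [df tf]; split; first exact: (domM hG hw).
by rewrite (tauZ hG hw) tf; apply/funext => v; rewrite !funE mulrCA.
Qed.

Lemma eigenD z f g : eigen z f -> eigen z g -> eigen z (f + g).
Proof.
move=> [df tf] [dg tg]; split; first exact: (domD hG hw).
by rewrite (tauD hG hw) tf tg fun_mulD.
Qed.

Lemma eigen0 z : eigen z 0.
Proof.
split; first exact: (dom0 hw).
have -> : tau 0 = 0 by rewrite -{1}(subrr 0) (tauB hG hw) subrr.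
by apply/funext => v; rewrite !funE mulr0.
Qed.

Lemma eigen_sum z (I : Type) (r : seq I) (F : I -> V -> R[i]) :
  (forall i, eigen z (F i)) -> eigen z (\sum_(i <- r) F i).
Proof.
by move=> h; elim/big_ind: _ => //; [exact: eigen0|move=> x y; exact: eigenD].
Qed.

Lemma eigen_tau_ell2 z f : eigen z f -> ell2 m (tau f).
Proof. by move=> [df ->]; apply: ell2M => //; exact: dom_ell2 df. Qed.

(* Symmetry tested against [i f]. *)
Lemma eigen_real z f : eigen z f -> f != 0 -> complex.Im z = 0.
Proof.
move=> ef f0; have f2 := dom_ell2 ef.1; have eif := eigenM 'i ef.
have := tau_symmetric hG hw ef.1 eif.1 (eigen_tau_ell2 ef) (eigen_tau_ell2 eif).
rewrite ef.2 eif.2 => h.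
have h1 : dot m (z \*o f) ('i \*o f) = complex.Im z * dot m f f.
  rewrite dotC dotM_conj (_ : _ \*o (z \*o f) = (('i)^* * z) \*o f).
    rewrite dotC dotM_self//; congr (_ * _); case: (z) => x y /=; ring.
  by apply/funext => v; rewrite !funE mulrA.
have h2 : dot m f (z \*o ('i \*o f)) = - complex.Im z * dot m f f.
  rewrite dotC (_ : z \*o _ = (z * 'i) \*o f).
    rewrite dotM_self//; congr (_ * _); case: (z) => x y /=; ring.
  by apply/funext => v; rewrite !funE mulrA.
move: h; rewrite h1 h2 => h.
have d0 : dot m f f != 0.
  by apply: contra_neq f0; exact: dot_eq0.
have : complex.Im z * dot m f f = 0 by lra.
by move/eqP; rewrite mulf_eq0 (negbTE d0) orbF => /eqP.
Qed.

Lemma eigen_orthogonal z z' f g : eigen z f -> eigen z' g -> z != z' ->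
  dot m f g = 0.
Proof.
move=> ef eg zz'.
have [->|f0] := eqVneq f 0; first by rewrite dotC dot0r.
have [->|g0] := eqVneq g 0; first by rewrite dot0r.
have Iz := eigen_real ef f0; have Iz' := eigen_real eg g0.
have f2 := dom_ell2 ef.1; have g2 := dom_ell2 eg.1.
have := tau_symmetric hG hw ef.1 eg.1 (eigen_tau_ell2 ef) (eigen_tau_ell2 eg).
rewrite ef.2 eg.2 [RHS]dotC.
have scal y x t : complex.Im y = 0 -> ell2 m x -> ell2 m t ->
    dot m (y \*o x) t = complex.Re y * dot m x t.
  case: y => y1 y2 /= -> x2 t2; rewrite /dot -rsumZ; last exact: (rsummable_cdot m_gt0).
  by congr rsum; apply/funext => v; rewrite /= -[y1 +i* 0]/(y1%:C) cdotZl mulrA.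
rewrite !scal// (dotC _ g f) => /eqP; rewrite -subr_eq0 -mulrBl mulf_eq0.
rewrite subr_eq0 => /orP[/eqP Re_eq|/eqP//].
by case/negP: zz'; rewrite eq_complex Re_eq Iz Iz' !eqxx.
Qed.

Variables (l c : R) (X : {fset V}).
Hypotheses (c_ge0 : 0 <= c).
Hypothesis hl : forall h, fin_supp h ->
  l * dot m h h <= q h h + c * \sum_(v <- X) cdot (h v) (h v) * m v.

Local Notation resolves := (resolves adj m b c X).

(** The potential moves to the right-hand side, where it depends only on the values of [f] on
    [X]. *)
Lemma resolvesP z f g : dom f -> tau f - z \*o f = g ->
  resolves z f (g + potential c X f).
Proof.
move=> df <-; split=> //.
by apply/funext => v; rewrite !funE; ring.
Qed.

Lemma resolvesP_inv z f g : resolves z f (g + potential c X f) ->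
  dom f /\ tau f - z \*o f = g.
Proof.
move=> [df e]; split=> //; apply/funext => v; have /(congr1 (fun h => h v)) := e.
rewrite !funE => e'; apply: (addIr (potential c X f v)); rewrite -e'; ring.
Qed.

(** The potential does not act on such an [f], which therefore solves the perturbed homogeneous
    equation and is zero by the resolvent bound. *)
Lemma eigen_vanish z f : complex.Re z < l -> eigen z f ->
  (forall v, v \in X -> f v = 0) -> f = 0.
Proof.
move=> zl [df tf] fX; have f2 := dom_ell2 df.
have : resolves z f (0 + potential c X f).
  by apply: resolvesP => //; rewrite tf subrr.
have -> : potential c X f = 0.
  apply/funext => v; rewrite /potential /rscale /= /restr; case: ifP => [/fX ->|_];
  by rewrite mulr0.
rewrite addr0 => /(resolves_bound hG hw hl zl (ell20 m_gt0)).
rewrite nrm0 pmulr_rle0 ?subr_gt0// => n0; apply: (nrm_eq0 m_gt0) => //.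
by apply/eqP; rewrite eq_le n0 nrm_ge0.
Qed.

Local Notation n := (size (enum_fset X)).
Definition vertex_of (j : 'I_n) : V := tnth (in_tuple (enum_fset X)) j.

Lemma vertex_of_surj v : v \in X -> exists j, v = vertex_of j.
Proof. by move=> vX; have [j ->] := seq_tnthP vX; exists j. Qed.

Definition dirac_at (j : 'I_n) : V -> R[i] := fun v => (v == vertex_of j)%:R.

Lemma dirac_at_ell2 j : ell2 m (dirac_at j).
Proof.
apply: (ell2_finite m_gt0).
apply: (@sub_finite_set _ _ [set vertex_of j]) => // v /=.
by rewrite /dirac_at; case: (v =P vertex_of j) => // _ /eqP[].
Qed.

Lemma potential_dirac f : potential c X f = c%:C \*o \sum_j (f (vertex_of j) \*o dirac_at j).
Proof.
apply/funext => v; rewrite funE /potential /rscale /=; congr (_ * _).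
rewrite fct_sumE /dirac_at /=.
rewrite -(big_tnth _ _ _ xpredT (fun u => f u * (v == u)%:R)) /restr.
case: ifP => vX.
  rewrite (big_fsetD1 v vX)/= eqxx mulr1 big_seq big1 ?addr0// => u.
  by rewrite !inE eq_sym => /andP[/negbTE -> _]; rewrite mulr0.
rewrite big_seq big1// => u uX; case: eqP => [vu|_]; last by rewrite mulr0.
by move: vX; rewrite vu uX.
Qed.

(** * Removing the potential: a linear system on the finite set *)

Section Fredholm.
Variables (z : R[i]) (psi : 'I_n -> V -> R[i]).
Hypothesis zl : complex.Re z < l.
Hypothesis hpsi : forall j, resolves z (psi j) (dirac_at j).

(** If [G] solves the perturbed equation with data [g], then [tau f - z f = g] amounts to
    [f = G + c * sum_i u_i psi_i], where [u] is the row of values of [f] on [X]. Evaluating at the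
    vertices of [X] leaves a linear system for [u] with this matrix and the values of [G] as
    right-hand side. *)
Definition fredholm_mx : 'M[R[i]]_n :=
  1%:M - c%:C *: \matrix_(i, j) psi i (vertex_of j).

Definition fredholm_corr (u : 'rV[R[i]]_n) : V -> R[i] := c%:C \*o \sum_i (u 0 i \*o psi i).

Lemma fredholm_mxE u j : (u *m fredholm_mx) 0 j = u 0 j - fredholm_corr u (vertex_of j).
Proof.
rewrite mulmxBr mulmx1 -scalemxAr !mxE; congr (_ - _ * _).
rewrite fct_sumE; apply: eq_bigr => i _.
by rewrite !mxE.
Qed.

Lemma resolves_fredholm_corr u :
  resolves z (fredholm_corr u) (c%:C \*o \sum_j (u 0 j \*o dirac_at j)).
Proof.
apply: (resolvesM hG hw); apply: (resolves_sum hG hw) => i.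
exact: (resolvesM hG hw).
Qed.

(** A null vector [u] is the row of values on [X] of its own correction; that function is therefore
    nonzero and solves the unperturbed equation with [g = 0]. *)
Lemma fredholm_singular : fredholm_mx \notin unitmx -> exists2 f, eigen z f & f != 0.
Proof.
rewrite -row_free_unit -kermx_eq0 => /rowV0Pn[u /sub_kermxP uA u0].
have cu j : fredholm_corr u (vertex_of j) = u 0 j.
  by apply/esym/eqP; rewrite -subr_eq0 -fredholm_mxE uA mxE.
exists (fredholm_corr u); last first.
  apply: contra_neq u0 => e; apply/rowP => j; rewrite -cu e mxE.
  by [].
have := resolves_fredholm_corr u; under eq_bigr do rewrite -cu.
rewrite -potential_dirac -[X in resolves _ _ X]add0r => /resolvesP_inv[df e]; split=> //.
by apply/eqP; rewrite -subr_eq0 e.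
Qed.

Lemma fredholm_solve : fredholm_mx \in unitmx -> forall g, ell2 m g ->
  exists2 f, dom f & tau f - z \*o f = g.
Proof.
move=> Au g g2; have [G hGg] := complex_resolvent hG hw c_ge0 hl zl g2.
pose u := (\row_j G (vertex_of j)) *m invmx fredholm_mx.
have uA : u *m fredholm_mx = \row_j G (vertex_of j) by rewrite mulmxKV.
have fu j : (G + fredholm_corr u) (vertex_of j) = u 0 j.
  have := fredholm_mxE u j; rewrite uA mxE fun_addE => ->; rewrite subrK//.
have := resolvesD hG hw hGg (resolves_fredholm_corr u).
under eq_bigr do rewrite -fu.
by rewrite -potential_dirac => /resolvesP_inv[df e]; exists (G + fredholm_corr u).
Qed.

(** [f] differs from the perturbed solution [G] by a combination of the [psi i] whose coefficients
    are linear in the values of [G] on [X]; these are bounded by the norm of [G], which the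
    perturbed resolvent bound controls. *)
Lemma fredholm_bound : fredholm_mx \in unitmx -> exists2 K, 0 <= K &
  forall f g, ell2 m g -> dom f -> tau f - z \*o f = g -> nrm m f <= K * nrm m g.
Proof.
move=> Au.
have psi2 i : ell2 m (psi i) by case: (hpsi i) => /dom_ell2.
have nc0 (x : R[i]) : 0 <= Normc.normc x by case: x => ? ? /=; rewrite sqrtr_ge0.
have ncD (x y : R[i]) : Normc.normc (x + y) <= Normc.normc x + Normc.normc y.
  have := ler_normD x y; rewrite !normc_def -rmorphD lecR.
  by case: x y => [? ?] [? ?].
have nc_sum (I : Type) (r : seq I) (F : I -> R[i]) :
    Normc.normc (\sum_(i <- r) F i) <= \sum_(i <- r) Normc.normc (F i).
  elim: r => [|i r IH]; first by rewrite !big_nil Normc.normc0.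
  by rewrite !big_cons; apply: le_trans (ncD _ _) _; rewrite lerD2l.
pose B i := \sum_j (Normc.normc (invmx fredholm_mx j i) / Num.sqrt (m (vertex_of j))).
pose C := c * \sum_i B i * nrm m (psi i).
have B0 i : 0 <= B i by rewrite sumr_ge0// => j _; rewrite divr_ge0 ?sqrtr_ge0.
have C0 : 0 <= C.
  by rewrite mulr_ge0// sumr_ge0// => i _; rewrite mulr_ge0 ?nrm_ge0.
have lz : 0 < l - complex.Re z by rewrite subr_gt0.
exists ((1 + C) / (l - complex.Re z)).
  by rewrite divr_ge0 ?(ltW lz)// addr_ge0.
move=> f g g2 df e; have [G hGg] := complex_resolvent hG hw c_ge0 hl zl g2.
have [/dom_ell2 G2 _] := hGg.
pose u := \row_j f (vertex_of j).
have fE : f = G + fredholm_corr u.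
  apply: (resolves_inj hG hw hl zl _ (resolvesP df e)).
    by apply: ell2D => //; exact: (potential_ell2 hw).
  rewrite potential_dirac; have := resolvesD hG hw hGg (resolves_fredholm_corr u).
  by under eq_bigr do rewrite mxE.
have uA : u *m fredholm_mx = \row_j G (vertex_of j).
  apply/rowP => j; rewrite fredholm_mxE !mxE {1}fE fun_addE addrK//.
have uE : u = (\row_j G (vertex_of j)) *m invmx fredholm_mx by rewrite -uA mulmxK.
have ub i : Normc.normc (u 0 i) <= nrm m G * B i.
  rewrite uE mxE; apply: le_trans (nc_sum _ _ _) _; rewrite mulr_sumr.
  apply: ler_sum => j _; rewrite Normc.normcM mxE mulrC mulrCA.
  by rewrite ler_wpM2l//; exact: normc_le_nrm.
have cb : nrm m (fredholm_corr u) <= C * nrm m G.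
  rewrite /fredholm_corr nrmM//; last by apply: ell2_sum => // i; exact: ell2M.
  rewrite (_ : Normc.normc c%:C = c); last first.
    by rewrite /= expr0n addr0 sqrtr_sqr ger0_norm.
  rewrite /C -mulrA ler_wpM2l// mulr_suml.
  apply: le_trans (nrm_sum m_gt0 _ _) _; first by move=> i; exact: ell2M.
  apply: ler_sum => i _; rewrite nrmM// mulrAC ler_wpM2r ?nrm_ge0// mulrC.
  exact: ub.
have Gb := resolves_bound hG hw hl zl g2 hGg.
rewrite fE; apply: le_trans (nrmD m_gt0 G2 _) _.
  by case: (resolves_fredholm_corr u) => /dom_ell2.
rewrite mulrAC ler_pdivlMr//.
apply: le_trans (_ : (1 + C) * ((l - complex.Re z) * nrm m G) <= _).
  by rewrite mulrCA mulrC ler_wpM2l ?(ltW lz)// mulrDl mul1r lerD2l.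
by rewrite ler_wpM2l// addr_ge0.
Qed.

Lemma fredholm_resolvent : fredholm_mx \in unitmx -> resolvent_set m T z.
Proof.
move=> Au; have [K K0 hK] := fredholm_bound Au; split.
  move=> g g2; have [f df e] := fredholm_solve Au g2.
  exists f; split.
    exists (tau f) => //; apply/(laplacianP hG hw); split=> //.
    rewrite -(subrK (z \*o f) (tau f)) e; apply: ell2D => //.
    by apply: ell2M => //; exact: dom_ell2 df.
  move=> f' [_ /(laplacianP hG hw)[df' _ ->] e'].
  have ed : tau (f - f') - z \*o (f - f') = 0.
    have e2 : tau f' - z \*o f' = g by exact: e'.
    have -> : 0 = (tau f - z \*o f) - (tau f' - z \*o f') by rewrite e e2 subrr.
    by rewrite (tauB hG hw); apply/funext => v; rewrite !funE; ring.
  have := hK _ _ (ell20 m_gt0) (domB hG hw df df') ed; rewrite nrm0 mulr0 => n0.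
  apply/eqP; rewrite -subr_eq0; apply/eqP/(nrm_eq0 m_gt0).
    by apply: ell2B => //; [exact: dom_ell2 df|exact: dom_ell2 df'].
  by apply/eqP; rewrite eq_le n0 nrm_ge0.
exists (K ^+ 2) => f w /(laplacianP hG hw)[df t2 e]; subst w.
have f2 := dom_ell2 df.
have g2 : ell2 m (tau f - z \*o f) by apply: ell2B => //; exact: ell2M.
have := hK _ _ g2 df erefl.
rewrite -[sqnorm m (_ \- _)]/(sqnorm m (tau f - z \*o f)) !sqnormE//.
rewrite -EFinM lee_fin -!nrm_sqr// -exprMn => h.
by rewrite ler_pXn2r ?nnegrE ?nrm_ge0 ?mulr_ge0 ?nrm_ge0.
Qed.

End Fredholm.

Lemma spectrum_eigen z : complex.Re z < l -> spectrum m T z ->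
  exists2 f, eigen z f & f != 0.
Proof.
move=> zl sz.
have ex j : exists f, resolves z f (dirac_at j).
  exact: (complex_resolvent hG hw c_ge0 hl zl (dirac_at_ell2 j)).
have [psi hpsi] := choice ex.
apply: (fredholm_singular hpsi); apply/negP => Au; apply: sz.
exact: (fredholm_resolvent zl hpsi).
Qed.

(** With more than [n] eigenfunctions some nontrivial combination [F] vanishes on [X]. As [F] mixes
    eigenvalues it need not be an eigenfunction, so the form is used instead: by orthogonality
    [dot m (tau F) F] is the sum of the [Re (zs i)] times the squared norms of the summands, and the
    lower bound, whose potential term is zero at [F], forces every summand to vanish. *)
Lemma eigenvalue_count (p : nat) (zs : 'I_p -> R[i]) (fs : 'I_p -> V -> R[i]) :
  injective zs -> (forall i, complex.Re (zs i) < l) ->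
  (forall i, eigen (zs i) (fs i)) -> (forall i, fs i != 0) -> (p <= n)%N.
Proof.
move=> zinj zsl ef f0; rewrite leqNgt; apply/negP => np.
pose M : 'M[R[i]]_(p, n) := \matrix_(i, j) fs i (vertex_of j).
have : ~~ row_free M.
  by rewrite /row_free neq_ltn (leq_ltn_trans (rank_leq_col M) np).
rewrite -kermx_eq0 => /rowV0Pn[u /sub_kermxP uM /negP]; apply.
pose g i := u 0 i \*o fs i; pose F := \sum_i g i.
have eg i : eigen (zs i) (g i) by exact: eigenM.
have g2 i : ell2 m (g i) := dom_ell2 (eg i).1.
have F2 : ell2 m F by exact: ell2_sum.
have dF : dom F by apply: (dom_sum hG hw) => i; case: (eg i).
have tF : tau F = \sum_i (zs i \*o g i).
  rewrite /F; elim/big_ind2: _ => [||i _]; last by case: (eg i).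
    by rewrite -{1}(subrr 0) (tauB hG hw) subrr.
  by move=> x1 x2 y1 y2 <- <-; rewrite (tauD hG hw).
have tF2 : ell2 m (tau F) by rewrite tF; apply: ell2_sum => // i; exact: ell2M.
have orth i j : i != j -> dot m (g i) (g j) = 0.
  by move=> ij; apply: (eigen_orthogonal (eg i) (eg j)); rewrite inj_eq.
have FX v : v \in X -> F v = 0.
  move=> /vertex_of_surj[j ->]; have /rowP/(_ j) := uM; rewrite !mxE => uMj.
  by rewrite /F fct_sumE -[RHS]uMj; apply: eq_bigr => i _; rewrite mxE.
have gF i : dot m (g i) F = dot m (g i) (g i).
  rewrite dotC dot_suml// (bigD1 i)//= big1 ?addr0// => j ji.
  exact: orth.
have NF : dot m F F = \sum_i dot m (g i) (g i).
  by rewrite {1}/F dot_suml//; apply: eq_bigr => i _; exact: gF.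
have qF : dot m (tau F) F = \sum_i complex.Re (zs i) * dot m (g i) (g i).
  rewrite tF dot_suml//; last by move=> i; exact: ell2M.
  apply: eq_bigr => i _; rewrite dotC dot_suml//; last exact: ell2M.
  rewrite (bigD1 i)//= big1 ?addr0; first by rewrite dotC dotM_self.
  move=> j ji; rewrite dotC -(eg i).2.
  have <- : dot m (g i) (tau (g j)) = dot m (tau (g i)) (g j).
    apply/esym/(tau_symmetric hG hw); [exact: (eg _).1..| |];
      exact: eigen_tau_ell2 (eg _).
  apply: (eigen_orthogonal (z := zs i) (z' := zs j) (eg i)); last by rewrite inj_eq// eq_sym.
  by rewrite (eg j).2; exact: eigenM.
have := dom_lower_bound hG hw hl dF tF2.
rewrite big_seq big1 ?mulr0 ?addr0; last by move=> v vX; rewrite FX// cdot0l mul0r.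
rewrite NF qF mulr_sumr -subr_ge0 -sumrB => h.
have g0 i : g i = 0.
  apply: (dot_eq0 m_gt0) => //; apply/eqP; rewrite eq_le dot_ge0// andbT leNgt.
  apply/negP => gi; move: h; apply/negP; rewrite -ltNge.
  rewrite (bigD1 i)//= -mulrBl -[ltRHS]addr0; apply: ltr_leD.
    by rewrite nmulr_rlt0// subr_lt0.
  apply: sumr_le0 => j _; rewrite -mulrBl mulr_le0_ge0 ?dot_ge0//.
  by rewrite subr_le0 ltW.
apply/eqP/rowP => i; rewrite mxE; apply/eqP; apply: contraNT (f0 i) => ui.
apply/eqP/funext => v; apply: (mulfI ui).
by rewrite -[LHS]/(g i v) g0 mulr0.
Qed.

Lemma finite_low_spectrum :
  finite_set [set z | spectrum m T z /\ complex.Re z < l].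
Proof.
apply: contrapT => /(@infinite_set_fset _ _ n.+1)[B BS nB].
have ex (z : B) : exists f, eigen (val z) f /\ f != 0.
  have [sz zl] := BS _ (valP z).
  by have [f ef f0] := spectrum_eigen zl sz; exists f.
have [fs hfs] := choice ex.
have := @eigenvalue_count #|{: B}| (fun i => val (enum_val i : B)) (fun i => fs (enum_val i)).
move=> h; have /(leq_trans nB) : (#|` B| <= n)%N.
  rewrite cardfE; apply: h => [i j /val_inj/enum_val_inj//|i|i|i].
  - by have [_] := BS _ (valP (enum_val i : B)).
  - by case: (hfs (enum_val i)).
  - by case: (hfs (enum_val i)).
by rewrite ltnn.
Qed.

(** A family of eigenfunctions whose values on [X] have maximal rank spans: adjoining [f] cannot
    raise the rank, so some combination agrees with [f] on [X], and [eigen_vanish] applies to the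
    difference. *)
Lemma eigenspace_finite_dim z : complex.Re z < l -> finite_dim (Defs.eigenspace T z).
Proof.
move=> zl.
pose mx k (e : 'I_k -> V -> R[i]) : 'M[R[i]]_(k, n) := \matrix_(i, j) e i (vertex_of j).
pose P r := `[< exists k (e : 'I_k -> V -> R[i]),
  (forall i, eigen z (e i)) /\ \rank (mx k e) = r >].
have P0 : exists r, P r.
  exists (\rank (mx 0%N (fun _ => 0))); apply/asboolP; exists 0%N, (fun=> 0).
  by split=> // i; exact: eigen0.
have Pn r : P r -> (r <= n)%N by move=> /asboolP[k [e [_ <-]]]; exact: rank_leq_col.
have [r /asboolP[k [e [he er]]] rmax] := ex_maxnP P0 Pn.
exists k, e => f /eigenspaceP ef.
pose e' (i : 'I_(1 + k)) := match fintype.split i with inl _ => f | inr j => e j end.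
pose rf : 'rV[R[i]]_n := \row_j f (vertex_of j).
have E : mx _ e' = col_mx rf (mx _ e).
  apply/matrixP => i j; rewrite !mxE /e'.
  by case: (fintype.split i) => i'; rewrite !mxE.
have le : (\rank (mx _ e') <= r)%N.
  apply: rmax; apply/asboolP; exists (1 + k)%N, e'; split=> // i.
  by rewrite /e'; case: (fintype.split i).
have sub : (mx _ e <= col_mx rf (mx _ e))%MS.
  by have := submx_refl (col_mx rf (mx _ e)); rewrite col_mx_sub => /andP[].
have := mxrank_leqif_sup sub; rewrite -E => -[ge eq].
have : (mx _ e' <= mx _ e)%MS by rewrite -eq eqn_leq ge er le.
rewrite E col_mx_sub => /andP[/submxP[D hD] _].
exists (fun i => D 0 i) => v.
pose g := f - \sum_i (D 0 i \*o e i).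
have eg : eigen z g.
  apply: eigenD => //.
  rewrite (_ : - _ = (-1) \*o \sum_i (D 0 i \*o e i)).
    by apply/eigenM/eigen_sum => i; exact: eigenM.
  by apply/funext => x; rewrite !funE mulN1r.
have g0 : g = 0.
  apply: (eigen_vanish zl eg) => x /vertex_of_surj[j ->].
  have /rowP/(_ j) := hD; rewrite !mxE /g !funE fct_sumE => ->.
  by apply/eqP; rewrite subr_eq0; apply/eqP/eq_bigr => i _; rewrite !mxE.
have /eqP := congr1 (fun h => h v) g0; rewrite /g !funE fct_sumE subr_eq0 => /eqP.
by [].
Qed.

Lemma low_spectrum_discrete z : complex.Re z < l -> spectrum m T z ->
  discrete_spectrum m T z.
Proof.
move=> zl sz; split; last exact: eigenspace_finite_dim.
- pose A := [set w | spectrum m T w /\ complex.Re w < l] `\ z.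
  have cA : @closed R[i]^o A.
    have acc : accessible_space R[i]^o by apply: hausdorff_accessible; exact: norm_hausdorff.
    apply: (((@accessible_finite_set_closed R[i]^o).1 acc) A).
    by apply: finite_setD; exact: finite_low_spectrum.
  split; first by rewrite inE.
  (* The radius keeps the ball inside [Re < l], where the spectral points other than [z] form the
     finite, hence closed, set [A]. *)
  exists (~` A `&` (ball (z : R[i]^o) (l - complex.Re z)%:C)).
    apply: filterI.
      apply: open_nbhs_nbhs; split; first exact: closed_openC.
      by move=> [_ /=]; apply.
    by apply: nbhsx_ballx; rewrite ltcR subr_gt0.
  apply/seteqP; split=> [w [[nA bw] sw]|_ ->].
    apply: contrapT => wz; apply: nA; split=> //; split=> //.
    move: bw; rewrite -ball_normE /= normc_def ltcR => bw.
    have : complex.Re (w - z) < l - complex.Re z.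
      apply: le_lt_trans bw; apply: le_trans (ler_norm _) _.
      rewrite -normrN (_ : - complex.Re (w - z) = complex.Re (z - w)); last first.
        by rewrite !ReB opprB.
      by rewrite -sqrtr_sqr ler_wsqrtr// lerDl sqr_ge0.
    by rewrite ReB ltrD2r.
  split=> //; split; first by move=> [_ /=]; apply.
  by apply: ballxx; rewrite ltcR subr_gt0.
- have [f ef f0] := spectrum_eigen zl sz; exists f; first exact/eigenspaceP.
  apply: contrapT => h; case/negP: f0; apply/eqP/funext => v.
  by apply/eqP/negP => /negP fv; apply: h; exists v.
Qed.

Lemma low_spectrum_empty z : X = fset0 -> complex.Re z < l -> ~ spectrum m T z.
Proof.
move=> X0 zl /(spectrum_eigen zl)[f ef /negP]; apply; apply/eqP.
by apply: (eigen_vanish zl ef) => v; rewrite X0.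
Qed.

End Spectral.

(** * From form bounds to isoperimetric constants *)

Section Bounds.
Variables (R : realType) (V : choiceType) (adj : rel V).
Variables (m : V -> R) (b : V -> V -> R) (d : {fset V} -> R).
Hypotheses (hG : is_graph adj) (hw : is_weight adj m b).
Hypotheses (hd : forall e, edges adj e -> 0 < d e) (hint : intrinsic adj m b d).

Local Notation iso := (isoperimetric adj m b d).
Local Notation T := (laplacian adj m b).

Lemma isoperimetric_ge0 U : (0 <= iso U)%E.
Proof.
apply: le_ereal_inf_tmp => _ [Y [_ fY _] <-]; rewrite lee_fin divr_ge0//.
  apply: fsumr_ge0 => e [u [v [_ _ uv ->]]].
  by rewrite (edge_weightE hw) (edge_length_weight_ge0 hw hd).
by apply: fsumr_ge0 => v _; rewrite ltW// (weight_vertex_gt0 hw).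
Qed.

(** An infinite isoperimetric constant has to be replaced by a real [a]; half the square of
    [|r| + 1] already exceeds [r]. *)
Lemma half_sqr_gt (r : R) (x : \bar R) : (0 <= x)%E ->
  (r%:E < (2^-1)%:E * x ^+ 2)%E ->
  exists a : R, [/\ 0 <= a, (a%:E <= x)%E & r < 2^-1 * a ^+ 2].
Proof.
case: x => [x x0|_|//]; first by rewrite -EFin_expe -EFinM lte_fin => rx; exists x.
move=> _; exists (`|r| + 1); split; [by rewrite addr_ge0|by rewrite leey|].
have := ler_norm r; have := normr_ge0 r; nra.
Qed.

(** Writing [r] as [t ^+ 2 / 2] with [t >= 0] turns the hypothesis into [t < ereal_sup S], and a
    supremum above [t] has a member above [t]. *)
Lemma half_sqr_sup (r : R) (S : set \bar R) : 0 <= r ->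
  (0 <= ereal_sup S)%E -> (forall x, S x -> (0 <= x)%E) ->
  (r%:E < (2^-1)%:E * ereal_sup S ^+ 2)%E ->
  exists2 x, S x & (r%:E < (2^-1)%:E * x ^+ 2)%E.
Proof.
move=> r0 S0 Spos h; set t := Num.sqrt (2 * r).
have t2 : 2^-1 * t ^+ 2 = r by rewrite sqr_sqrtr ?mulr_ge0// mulKf.
have : (t%:E < ereal_sup S)%E.
  rewrite ltNge; apply/negP => St; move: h; apply/negP; rewrite -leNgt.
  rewrite -t2 EFinM EFin_expe lee_wpmul2l// ?lee_fin//.
  by rewrite lee_sqr// lee_fin sqrtr_ge0.
move=> /ereal_sup_gt[x Sx tx]; exists x => //.
rewrite -t2; move: (Spos _ Sx) tx; case: x {Sx} => [x| |//].
  rewrite -EFin_expe -EFinM !lte_fin lee_fin => x0 tx.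
  by rewrite ltr_pM2l// ltr_pXn2r ?nnegrE ?sqrtr_ge0.
move=> _ _; rewrite expe2 mulyy.
by rewrite gt0_muley ?ltry// lte_fin.
Qed.

Lemma below_isoperimetric (X : {fset V}) z :
  ((complex.Re z)%:E < (2^-1)%:E * iso (~` [set` X]) ^+ 2)%E ->
  spectrum m T z -> discrete_spectrum m T z /\ X <> fset0.
Proof.
move=> /(half_sqr_gt (isoperimetric_ge0 _))[a [a0 aX za]] sz.
(* The midpoint leaves strict room on both sides: above the spectral point, and below the Cheeger
   bound. *)
pose l := (complex.Re z + 2^-1 * a ^+ 2) / 2.
have zl : complex.Re z < l by rewrite /l; lra.
have la : l < 2^-1 * a ^+ 2 by rewrite /l; lra.
have [c c0 hl] := perturbed_bound hG hw hd hint a0 aX la.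
split; first exact: (low_spectrum_discrete hG hw c0 hl zl sz).
by move=> X0; exact: (low_spectrum_empty hG hw c0 hl X0 zl).
Qed.

End Bounds.

Theorem theoremA1 (R : realType) (V : choiceType) (adj : rel V)
    (m : V -> R) (b : V -> V -> R) (d : {fset V} -> R)
    (hG : is_graph adj) (hw : is_weight adj m b)
    (hd : forall e, edges adj e -> 0 < d e)
    (hint : intrinsic adj m b d) :
  ((2^-1)%:E * isoperimetric adj m b d [set: V] ^+ 2 <= lambda0 adj m b)%E /\
  ((2^-1)%:E * isoperimetric_ess adj m b d ^+ 2 <= lambda0_ess adj m b)%E.
Proof.
(* The global bound is the case of the empty exceptional set, in which no spectrum lies below. *)
have noX : [set: V] = ~` [set` (fset0 : {fset V})].
  by apply/seteqP; split.
have spos z : spectrum m (laplacian adj m b) z ->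
  ((2^-1)%:E * isoperimetric adj m b d [set: V] ^+ 2 <= (complex.Re z)%:E)%E.
  move=> sz; rewrite leNgt; apply/negP; rewrite noX.
  by move=> /(below_isoperimetric hG hw hd hint)/(_ sz)[].
split; first by apply: le_ereal_inf_tmp => _ [z sz <-]; exact: spos.
apply: le_ereal_inf_tmp => _ [z [sz ndz] <-].
rewrite leNgt; apply/negP => h; apply: ndz.
(* The square root in [half_sqr_sup] calls for a nonnegative real part, which the first inequality
   provides. *)
have z0 : 0 <= complex.Re z.
  rewrite -lee_fin; apply: le_trans (spos z sz).
  by rewrite mule_ge0 ?lee_fin ?expe_ge0// (isoperimetric_ge0 hw hd).
have [||_ [X fX <-] hX] := half_sqr_sup z0 _ _ h.
(* The member for the empty set already makes the supremum nonnegative. *)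
- apply: le_ereal_sup_tmp; exists (isoperimetric adj m b d (~` set0)).
    by exists set0 => //; exact: finite_set0.
  exact: (isoperimetric_ge0 hw hd).
- by move=> _ [X _ <-]; exact: (isoperimetric_ge0 hw hd).
move: hX; rewrite -(fset_setK fX) => hX.
by have [] := below_isoperimetric hG hw hd hint hX sz.
Qed.
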